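(* Let $\mathcal V$ be a locally admissible variety of noncommutative Jordan algebras over an associative commutative ring $\Phi$, and let $Z$ be an ideal of the ring $\Phi$. Then the locally finite over $Z$ radical exists in $\mathcal V$.
   Context: $\Phi$ is unital and contains $\tfrac12$, and the variety $\mathcal V$ is homogeneous (if an identity holds in $\mathcal V$ then so do all its homogeneous components). Notation: $(x,y,z)=(xy)z-x(yz)$. A noncommutative Jordan algebra is an algebra satisfying $(x,y,x)=0$ and $(x^2,y,x)=0$. For an algebra $A$, $A^m$ denotes the span of all products of $m$ elements of $A$ with all arrangements of parentheses; $A$ is nilpotent if $A^m=0$ for some $m$. A variety $\mathcal V$ of noncommutative Jordan algebras is locally admissible if every anticommutative algebra in $\mathcal V$ is locally nilpotent (every finitely generated subalgebra is nilpotent). A finitely generated algebra $A$ over $\Phi$ is called finite over $Z$ (in Shirshov's sense) if for some natural number $m$ there exist finitely many elements $a_1,\ldots,a_n\in A$ such that $A^m\subseteq Za_1+\cdots+Za_n$. An algebra is locally finite over $Z$ if each of its finitely generated subalgebras is finite over $Z$. ''The locally finite over $Z$ radical exists in $\mathcal V$'' means that local finiteness over $Z$ is a radical property in $\mathcal V$: homomorphic images of locally finite over $Z$ algebras of $\mathcal V$ are locally finite over $Z$; every algebra $A\in\mathcal V$ has a largest ideal $L(A)$ which is locally finite over $Z$ (it contains all ideals of $A$ that are locally finite over $Z$); and the quotient $A/L(A)$ has no nonzero ideals locally finite over $Z$. *)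

(* Defs.v *)
From HB Require Import structures.
From mathcomp Require Import all_boot all_order all_algebra.
From mathcomp Require Import boolp classical_sets.
From mathcomp.finmap Require Import finmap.
From mathcomp.multinomials Require Import monalg.

Set Implicit Arguments.
Unset Strict Implicit.
Unset Printing Implicit Defensive.

Import GRing.Theory.
Local Open Scope classical_set_scope.
Local Open Scope quotient_scope.
Local Open Scope ring_scope.

Reserved Notation "x ** y" (at level 40, left associativity).

(* Algebras over Phi: neither associativity, commutativity nor a unit is
   assumed. *)
HB.mixin Record Lmodule_isNAlgebra (Phi : comPzRingType) A
    of GRing.Lmodule Phi A := {
  nmul : A -> A -> A;
  nmulDl : left_distributive nmul +%R;
  nmulDr : right_distributive nmul +%R;
  nmulZl : forall (a : Phi) (x y : A), nmul (a *: x) y = a *: nmul x y;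
  nmulZr : forall (a : Phi) (x y : A), nmul x (a *: y) = a *: nmul x y
}.

#[short(type="nalgType")]
HB.structure Definition NAlgebra (Phi : comPzRingType) :=
  {A of GRing.Lmodule Phi A & Lmodule_isNAlgebra Phi A}.

Notation "x ** y" := (nmul x y) : ring_scope.

Section Subspaces.
Variables (Phi : comPzRingType) (M : lmodType Phi).

Definition is_submod (N : set M) : Prop :=
  [/\ N 0, forall x y, N x -> N y -> N (x + y)
    & forall (a : Phi) x, N x -> N (a *: x)].

Definition lspan (S : set M) : set M := smallest is_submod S.

Definition Zspan (Z : set Phi) (n : nat) (a : 'I_n -> M) : set M :=
  [set x | exists2 z : 'I_n -> Phi,
             forall i, Z (z i) & x = \sum_(i < n) z i *: a i].

End Subspaces.

Section Algebras.
Variables (Phi : comPzRingType) (A : nalgType Phi).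

Definition is_subalg (B : set A) : Prop :=
  is_submod B /\ forall x y, B x -> B y -> B (x ** y).

Definition subalg_gen (S : set A) : set A := smallest is_subalg S.

Definition is_ideal (I : set A) : Prop :=
  is_submod I /\ forall x y, I x -> I (x ** y) /\ I (y ** x).

Record ideal := Ideal { ideal_set :> set A; idealP : is_ideal ideal_set }.

Inductive nprod (B : set A) : nat -> A -> Prop :=
| NProd1 x : B x -> nprod B 1 x
| NProdM p q x y : nprod B p x -> nprod B q y -> nprod B (p + q) (x ** y).

(* B^m.  Only m > 0 is meaningful: there are no products of 0 elements, so
   [npow B 0] is the zero subspace; hence the conditions 0 < m below. *)
Definition npow (B : set A) (m : nat) : set A := lspan (nprod B m).

Definition nilpotent_subalg (B : set A) : Prop :=
  exists2 m, (0 < m)%N & npow B m `<=` [set 0].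

Definition finite_over (Z : set Phi) (B : set A) : Prop :=
  exists m n (a : 'I_n -> A),
    [/\ (0 < m)%N, forall i, B (a i) & npow B m `<=` Zspan Z a].

(* Every finitely generated subalgebra of the subalgebra B has property P; for
   B = setT this is the property "locally P" of the algebra A itself. *)
Definition locally (P : set A -> Prop) (B : set A) : Prop :=
  forall s : seq A, [set` s] `<=` B -> P (subalg_gen [set` s]).

Definition locally_nilpotent (B : set A) : Prop := locally nilpotent_subalg B.

Definition locally_finite_over (Z : set Phi) (B : set A) : Prop :=
  locally (finite_over Z) B.

Definition associator (x y z : A) : A := (x ** y) ** z - x ** (y ** z).

Definition noncommutative_jordan : Prop :=
  (forall x y, associator x y x = 0) /\
  (forall x y, associator (x ** x) y x = 0).

Definition anticommutative : Prop := forall x y : A, x ** y = - (y ** x).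

End Algebras.

Section QuotientAlgebra.
Variables (Phi : comPzRingType) (A : nalgType Phi) (I : ideal A).

Definition ideal_pred : {pred A} := fun x => `[< ideal_set I x >].

Lemma ideal_predP x : reflect (ideal_set I x) (x \in ideal_pred).
Proof. exact: asboolP. Qed.

Lemma ideal_pred_zmod : zmod_closed ideal_pred.
Proof.
case: (idealP I) => -[I0 ID IZ] _; split; first exact/ideal_predP.
move=> x y /ideal_predP Ix /ideal_predP Iy; apply/ideal_predP.
by apply: ID => //; rewrite -scaleN1r; apply: IZ.
Qed.

HB.instance Definition _ := GRing.isZmodClosed.Build A ideal_pred
  ideal_pred_zmod.

Definition quot_alg := Quotient.quot ideal_pred.

HB.instance Definition _ := GRing.Zmodule.on quot_alg.
HB.instance Definition _ := EqQuotient.on quot_alg.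

Lemma quot_algE (x y : A) :
  \pi_quot_alg x = \pi_quot_alg y <-> ideal_set I (x - y).
Proof.
split=> [/eqP|Ixy]; last by apply/eqP; rewrite -Quotient.idealrBE; apply/asboolP.
by rewrite -Quotient.idealrBE => /asboolP.
Qed.

Lemma quot_alg_piD : {morph \pi_quot_alg : x y / x + y}.
Proof. by move=> x y; rewrite !piE. Qed.

Definition quot_scale (a : Phi) (x : quot_alg) : quot_alg :=
  \pi_quot_alg (a *: repr x).

Definition quot_mul (x y : quot_alg) : quot_alg :=
  \pi_quot_alg (repr x ** repr y).

Lemma nmulBl (x y z : A) : (x - y) ** z = x ** z - y ** z.
Proof. by rewrite nmulDl -scaleN1r nmulZl scaleN1r. Qed.

Lemma nmulBr (x y z : A) : x ** (y - z) = x ** y - x ** z.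
Proof. by rewrite nmulDr -scaleN1r nmulZr scaleN1r. Qed.

Lemma repr_pi_sub (x : A) : ideal_set I (repr (\pi_quot_alg x) - x).
Proof. by apply/quot_algE; rewrite reprK. Qed.

Lemma quot_scale_pi (a : Phi) (x : A) :
  quot_scale a (\pi_quot_alg x) = \pi_quot_alg (a *: x).
Proof.
apply/quot_algE; rewrite -scalerBr.
by case: (idealP I) => -[_ _ IZ] _; apply/IZ/repr_pi_sub.
Qed.

Lemma quot_mul_pi (x y : A) :
  quot_mul (\pi_quot_alg x) (\pi_quot_alg y) = \pi_quot_alg (x ** y).
Proof.
case: (idealP I) => -[I0 ID IZ] IM; apply/quot_algE.
set x' := repr _; set y' := repr _.
have -> : x' ** y' - x ** y = (x' - x) ** y' + x ** (y' - y).
  by rewrite nmulBl nmulBr addrA subrK.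
apply: ID; first by apply: (IM _ _ _).1; apply: repr_pi_sub.
by apply: (IM _ _ _).2; apply: repr_pi_sub.
Qed.

Lemma quot_scaleA (a b : Phi) x :
  quot_scale a (quot_scale b x) = quot_scale (a * b) x.
Proof. by elim/quotW: x => x; rewrite (quot_scale_pi b) !quot_scale_pi scalerA. Qed.

Lemma quot_scale1 : left_id 1 quot_scale.
Proof. by elim/quotW=> x; rewrite quot_scale_pi scale1r. Qed.

Lemma quot_scaleDr : right_distributive quot_scale +%R.
Proof.
move=> a; elim/quotW=> x; elim/quotW=> y.
by rewrite -quot_alg_piD !quot_scale_pi scalerDr quot_alg_piD.
Qed.

Lemma quot_scaleDl x : {morph quot_scale^~ x : a b / a + b}.
Proof.
by elim/quotW: x => x a b; rewrite !quot_scale_pi scalerDl quot_alg_piD.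
Qed.

HB.instance Definition _ := GRing.Zmodule_isLmodule.Build Phi quot_alg
  quot_scaleA quot_scale1 quot_scaleDr quot_scaleDl.

Lemma quot_alg_piZ (a : Phi) (x : A) :
  \pi_quot_alg (a *: x) = a *: \pi_quot_alg x.
Proof. by rewrite -quot_scale_pi. Qed.

Lemma quot_mulDl : left_distributive quot_mul +%R.
Proof.
elim/quotW=> x; elim/quotW=> y; elim/quotW=> z.
by rewrite -quot_alg_piD !quot_mul_pi nmulDl quot_alg_piD.
Qed.

Lemma quot_mulDr : right_distributive quot_mul +%R.
Proof.
elim/quotW=> x; elim/quotW=> y; elim/quotW=> z.
by rewrite -quot_alg_piD !quot_mul_pi nmulDr quot_alg_piD.
Qed.

Lemma quot_mulZl (a : Phi) (x y : quot_alg) :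
  quot_mul (a *: x) y = a *: quot_mul x y.
Proof.
elim/quotW: x => x; elim/quotW: y => y.
by rewrite -quot_alg_piZ !quot_mul_pi nmulZl quot_alg_piZ.
Qed.

Lemma quot_mulZr (a : Phi) (x y : quot_alg) :
  quot_mul x (a *: y) = a *: quot_mul x y.
Proof.
elim/quotW: x => x; elim/quotW: y => y.
by rewrite -quot_alg_piZ !quot_mul_pi nmulZr quot_alg_piZ.
Qed.

HB.instance Definition _ := Lmodule_isNAlgebra.Build Phi quot_alg
  quot_mulDl quot_mulDr quot_mulZl quot_mulZr.

End QuotientAlgebra.

(* The free magma on the variables x_0, x_1, ... *)
Inductive word := Var of nat | Mul of word & word.

Fixpoint word_encode (w : word) : GenTree.tree nat :=
  match w with
  | Var i => GenTree.Leaf i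
  | Mul u v => GenTree.Node 0 [:: word_encode u; word_encode v]
  end.

Fixpoint word_decode (t : GenTree.tree nat) : word :=
  match t with
  | GenTree.Leaf i => Var i
  | GenTree.Node _ [:: u; v] => Mul (word_decode u) (word_decode v)
  | _ => Var 0
  end.

Lemma word_encodeK : cancel word_encode word_decode.
Proof. by elim=> //= u -> v ->. Qed.

HB.instance Definition _ := Choice.copy word (can_type word_encodeK).

(* The list of variables of w; up to [perm_eq] it is the multidegree of w. *)
Fixpoint leaves (w : word) : seq nat :=
  match w with
  | Var i => [:: i]
  | Mul u v => leaves u ++ leaves v
  end.

(* Underlying module of the free nonassociative algebra Phi{x_0, x_1, ...} *)
Definition npoly (Phi : comPzRingType) := {malg Phi[word]}.

(* Homogeneous component of f: the sum of its monomials having the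
   multidegree represented by s. *)
Definition homogeneous_component (Phi : comPzRingType) (s : seq nat)
    (f : npoly Phi) : npoly Phi :=
  \sum_(w <- msupp f | perm_eq (leaves w) s) << f@_w *g w >>.

Section Identities.
Variables (Phi : comPzRingType) (A : nalgType Phi).

Fixpoint word_eval (v : nat -> A) (w : word) : A :=
  match w with
  | Var i => v i
  | Mul w1 w2 => word_eval v w1 ** word_eval v w2
  end.

Definition npoly_eval (v : nat -> A) (f : npoly Phi) : A :=
  \sum_(w <- msupp f) f@_w *: word_eval v w.

Definition satisfies (f : npoly Phi) : Prop :=
  forall v : nat -> A, npoly_eval v f = 0.

End Identities.

(* A variety is given by a set of defining identities. *)
Definition variety (Phi : comPzRingType) := set (npoly Phi).

Section Varieties.
Variables (Phi : comPzRingType) (V : variety Phi).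

Definition in_variety (A : nalgType Phi) : Prop :=
  forall f, V f -> satisfies A f.

Definition holds_in_variety (f : npoly Phi) : Prop :=
  forall A : nalgType Phi, in_variety A -> satisfies A f.

Definition homogeneous_variety : Prop :=
  forall f, holds_in_variety f ->
    forall s : seq nat, holds_in_variety (homogeneous_component s f).

Definition noncommutative_jordan_variety : Prop :=
  forall A : nalgType Phi, in_variety A -> noncommutative_jordan A.

Definition locally_admissible : Prop :=
  forall A : nalgType Phi, in_variety A -> anticommutative A ->
    locally_nilpotent (@setT A).

Definition locally_finite_radical_exists (Z : set Phi) : Prop :=
  (forall (A B : nalgType Phi) (f : {linear A -> B}),
     in_variety A -> locally_finite_over Z (@setT A) ->
     (forall x y, f (x ** y) = f x ** f y) -> (forall b, exists a, f a = b) ->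
     locally_finite_over Z (@setT B)) /\
  (forall A : nalgType Phi, in_variety A ->
     exists L : ideal A,
       [/\ locally_finite_over Z L,
           forall I : ideal A, locally_finite_over Z I -> I `<=` L
         & forall J : ideal (quot_alg L),
             locally_finite_over Z J -> J `<=` [set 0]]).

End Varieties.

(* Main.v *)
(* The Jordan product x ∘ y = xy + yx makes a noncommutative Jordan algebra A
   into a Jordan algebra on which the commutators act by derivations.  Hence
   A ∘ A is an ideal of A, and A / (A ∘ A) is anticommutative, so locally
   nilpotent.  Applied to the free algebra of the variety, and by homogeneity,
   this writes every long product of given generators as a combination of
   Jordan products of shorter products of the same total degree.

   The heart of the matter is closure under extensions: if I is a locally
   finite ideal and a finitely generated algebra B is finite over Z modulo I,
   then B is finite over Z.  Let the letters be the short products of the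
   generators of B; products of two letters are letters up to finitely many
   u_ij in I (and coefficients in Z).  Count the letters and u_ij in the
   elements obtained from the u_ij by Jordan multiplication by letters and by
   each other.  Modulo elements with fewer factors and modulo Jordan products
   of two such elements, the linearized Jordan identity gives
     ((x ∘ y) ∘ z) ∘ a = 0,   ((x ∘ y) ∘ a) ∘ b = 0,
     ((x ∘ b) ∘ y) ∘ a = - ((x ∘ a) ∘ y) ∘ b
   for x, y, z in I and letters a, b, and a chain ((u ∘ a) ∘ b) ∘ c ... is
   skew-symmetric in letters at distance two.  What remains are binary trees
   that are skew-symmetric in their letters; as there are finitely many
   letters, large trees vanish.  So all these elements lie in the subalgebra
   generated by finitely many elements of I, which is finite over Z.  Weights
   (degrees in the generators) are carried along, lowering the weight being
   allowed at the price of a coefficient from Z; they turn the bound on the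
   number of factors into the statement that B^m lies in a Z-span. *)

Require Import Defs.
From HB Require Import structures.
From mathcomp Require Import all_boot all_order all_algebra.
From mathcomp Require Import boolp classical_sets.
From mathcomp.finmap Require Import finmap.
From mathcomp.multinomials Require Import monalg.
From mathcomp Require Import zify.

Set Implicit Arguments.
Unset Strict Implicit.
Unset Printing Implicit Defensive.

Import GRing.Theory.
Local Open Scope classical_set_scope.
Local Open Scope ring_scope.

(** * A decision procedure for identities of abelian groups *)

Inductive zexpr := ZVar of nat | ZZero | ZAdd of zexpr & zexpr | ZOpp of zexpr.

Fixpoint zeval (M : zmodType) (env : seq M) (e : zexpr) : M :=
  match e with
  | ZVar i => env`_i
  | ZZero => 0
  | ZAdd e1 e2 => zeval env e1 + zeval env e2
  | ZOpp e1 => - zeval env e1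
  end.

Fixpoint zcoef (i : nat) (e : zexpr) : int :=
  match e with
  | ZVar j => (i == j)%:Z
  | ZZero => 0
  | ZAdd e1 e2 => zcoef i e1 + zcoef i e2
  | ZOpp e1 => - zcoef i e1
  end.

Lemma zevalE (M : zmodType) (env : seq M) (e : zexpr) :
  zeval env e = \sum_(i < size env) env`_i *~ zcoef i e.
Proof.
elim: e => [j||e1 IH1 e2 IH2|e IH] /=.
- case: (ltnP j (size env)) => hj.
    rewrite (bigD1 (Ordinal hj)) //= eqxx mulr1z big1 ?addr0 // => i.
    by rewrite -val_eqE /= => /negbTE->; rewrite mulr0z.
  rewrite nth_default // big1 // => i _.
  by rewrite (ltn_eqF (leq_trans (ltn_ord i) hj)) mulr0z.
- by rewrite big1 // => i _; rewrite mulr0z.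
- by rewrite IH1 IH2 -big_split /=; apply: eq_bigr => i _; rewrite mulrzDr.
- by rewrite IH -sumrN; apply: eq_bigr => i _; rewrite mulrNz.
Qed.

(** Soundness of [zmod]: comparing integer coefficients is a computation, so [isT] proves the
    premise. *)
Lemma zeval_eq (M : zmodType) (env : seq M) (e1 e2 : zexpr) :
  all (fun i => zcoef i e1 == zcoef i e2) (iota 0 (size env)) ->
  zeval env e1 = zeval env e2.
Proof.
move/allP=> h; rewrite !zevalE; apply: eq_bigr => i _.
by rewrite (eqP (h i _)) // mem_iota /= add0n.
Qed.

Ltac zatom env x :=
  lazymatch env with
  | nil => constr:(cons x nil)
  | cons ?y ?l =>
      match goal with
      | _ => let _ := match goal with _ => constr_eq x y end in env
      | _ => let l' := zatom l x in constr:(cons y l')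
      end
  end.

Ltac zatoms env t :=
  lazymatch t with
  | (?x + ?y)%R => let env1 := zatoms env x in zatoms env1 y
  | (- ?x)%R => zatoms env x
  | 0%R => env
  | _ => zatom env t
  end.

Ltac zindex env x :=
  lazymatch env with
  | cons ?y ?l =>
      match goal with
      | _ => let _ := match goal with _ => constr_eq x y end in constr:(O)
      | _ => let n := zindex l x in constr:(S n)
      end
  end.

Ltac zreify env t :=
  lazymatch t with
  | (?x + ?y)%R => let a := zreify env x in let b := zreify env y in
                   constr:(ZAdd a b)
  | (- ?x)%R => let a := zreify env x in constr:(ZOpp a)
  | 0%R => constr:(ZZero)
  | _ => let n := zindex env t in constr:(ZVar n)
  end.

Ltac zmod :=
  lazymatch goal with
  | |- ?x = ?y :> ?T =>
      let env0 := zatoms constr:(@nil T) x in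
      let env := zatoms env0 y in
      let a := zreify env x in
      let b := zreify env y in
      exact: (@zeval_eq _ env a b isT)
  end.

(** * The Jordan product *)

HB.lock Definition jmul (Phi : comPzRingType) (A : nalgType Phi) (x y : A) : A :=
  x ** y + y ** x.

Notation "x ∘ y" := (jmul x y) (at level 40, left associativity) : ring_scope.

Section JordanProduct.
Variables (Phi : comPzRingType) (A : nalgType Phi).
Implicit Types x y z t : A.

Lemma jmulE x y : x ∘ y = x ** y + y ** x.
Proof. by rewrite jmul.unlock. Qed.

Lemma nmulNr (x y : A) : x ** (- y) = - (x ** y).
Proof. by rewrite -scaleN1r nmulZr scaleN1r. Qed.

Lemma nmul0l (x : A) : 0 ** x = 0.
Proof. by rewrite -[0 in LHS](subrr x) nmulBl subrr. Qed.

Lemma nmul0r (x : A) : x ** 0 = 0.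
Proof. by rewrite -[0 in LHS](subrr x) nmulBr subrr. Qed.

Lemma jmulC x y : x ∘ y = y ∘ x.
Proof. by rewrite !jmulE addrC. Qed.

Lemma jmulDl x y z : (x + y) ∘ z = x ∘ z + y ∘ z.
Proof. rewrite !jmulE nmulDl nmulDr; zmod. Qed.

Lemma jmulDr x y z : z ∘ (x + y) = z ∘ x + z ∘ y.
Proof. by rewrite jmulC jmulDl !(jmulC z). Qed.

Lemma jmulZl a x y : (a *: x) ∘ y = a *: (x ∘ y).
Proof. by rewrite !jmulE nmulZl nmulZr scalerDr. Qed.

Lemma jmulZr a x y : x ∘ (a *: y) = a *: (x ∘ y).
Proof. by rewrite jmulC jmulZl jmulC. Qed.

Lemma jmulNl x y : (- x) ∘ y = - (x ∘ y).
Proof. by rewrite -scaleN1r jmulZl scaleN1r. Qed.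

Lemma jmul0l x : 0 ∘ x = 0.
Proof. by rewrite !jmulE nmul0l nmul0r addr0. Qed.

Hypothesis A_jordan : noncommutative_jordan A.

(** Linearization of [(x,y,x) = 0] in the outer argument. *)
Lemma flexible x y z : associator x y z = - associator z y x.
Proof.
apply/eqP; rewrite -addr_eq0; apply/eqP.
have e : associator (x + z) y (x + z) = associator x y x + associator x y z
    + associator z y x + associator z y z.
  rewrite /associator !(nmulDl, nmulDr); zmod.
by move: e; rewrite !A_jordan.1 add0r addr0 => ->.
Qed.

(** Two instances of the Teichmüller identity [teich], valid in every algebra, together with
    flexibility give [(x^2,x,y) = (x,x^2,y)]. The rest is an expansion into associators. *)
Lemma jordan_identity x y : ((x ∘ x) ∘ y) ∘ x = (x ∘ x) ∘ (y ∘ x).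
Proof.
have [h1 h2] := A_jordan.
have teich (a b c d : A) : associator (a ** b) c d - associator a (b ** c) d
    + associator a b (c ** d) = a ** associator b c d + associator a b c ** d.
  rewrite /associator !(nmulBl, nmulBr); zmod.
have e1 := teich x y x x.
have e2 := teich x x x y.
rewrite !h1 (flexible x y) h2 nmul0l oppr0 !addr0 in e1.
rewrite h1 nmul0l addr0 in e2.
have e3 : associator x x (x ** y) = x ** associator x x y.
  by rewrite flexible e1 (flexible y) nmulNr opprK.
have e4 : associator (x ** x) x y = associator x (x ** x) y.
  apply/subr0_eq; move: e2; rewrite e3 => e2.
  by apply: (addIr (x ** associator x x y)); rewrite e2 add0r.
have e5 : associator y x (x ** x) = associator y (x ** x) x.
  by rewrite flexible e4 flexible opprK.
have e6 := h2 x y.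
have e7 : associator x y (x ** x) = 0 by rewrite flexible h2 oppr0.
have e8 : associator x x x = 0 by exact: h1.
have xx : x ** x ** x = x ** (x ** x).
  by apply/subr0_eq.
have main : (x ** x) ∘ y ∘ x - (x ** x) ∘ (y ∘ x) =
    associator (x ** x) y x - associator x y (x ** x)
    + associator y (x ** x) x - associator y x (x ** x)
    - associator x (x ** x) y + associator (x ** x) x y.
  rewrite !jmulE /associator !(nmulDl, nmulDr) xx; zmod.
move: main; rewrite e4 e5 e6 e7 => main.
have {}main : (x ** x) ∘ y ∘ x - (x ** x) ∘ (y ∘ x) = 0 by rewrite main; zmod.
have -> : x ∘ x = x ** x + x ** x by rewrite jmulE.
by rewrite !jmulDl (subr0_eq main).
Qed.

Hypothesis half_in_Phi : exists h : Phi, h *+ 2 = 1.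

Lemma double_eq0 (M : lmodType Phi) (x : M) : x + x = 0 -> x = 0.
Proof.
have [h hh] := half_in_Phi => e.
by rewrite -[x]scale1r -hh mulr2n scalerDl -scalerDr e scaler0.
Qed.

(** Full polarization of [jordan_identity], which is cubic in [x]; by commutativity each term
    appears twice, whence the division by 2. *)
Lemma jordan_linearized x y z t :
  ((x ∘ z) ∘ y) ∘ t + ((z ∘ t) ∘ y) ∘ x + ((t ∘ x) ∘ y) ∘ z =
  (x ∘ z) ∘ (y ∘ t) + (z ∘ t) ∘ (y ∘ x) + (t ∘ x) ∘ (y ∘ z).
Proof.
pose F u := ((u ∘ u) ∘ y) ∘ u - (u ∘ u) ∘ (y ∘ u).
have F0 u : F u = 0 by rewrite /F jordan_identity subrr.
apply/subr0_eq/double_eq0.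
(* Inclusion and exclusion keep only the part of [F] linear in each of [x], [z], [t]. *)
have : F (x + z + t) - F (x + z) - F (z + t) - F (x + t) + F x + F z + F t = 0.
  by rewrite !F0; zmod.
move=> <-; rewrite /F !(jmulDl, jmulDr) (jmulC z x) (jmulC t z) (jmulC t x).
zmod.
Qed.

Definition bracket (x y : A) : A := x ** y - y ** x.

(** The defect of this derivation rule is a combination of three instances of the flexible law. *)
Lemma bracket_jmul x y z :
  bracket (x ∘ y) z = x ∘ bracket y z + bracket x z ∘ y.
Proof.
have e1 := flexible x y z; have e2 := flexible y x z.
have e3 := flexible x z y.
apply/subr0_eq.
have -> : bracket (x ∘ y) z - (x ∘ bracket y z + bracket x z ∘ y) =
   (associator x y z + associator z y x) + (associator y x z + associator z x y)
   - (associator x z y + associator y z x).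
  rewrite /bracket !jmulE /associator !(nmulDl, nmulDr, nmulBl, nmulBr); zmod.
by rewrite e1 e2 e3 !addNr; zmod.
Qed.

End JordanProduct.

(** * Submodules *)

Section Submodules.
Variables (Phi : comPzRingType) (M : lmodType Phi).
Implicit Types (N S : set M) (x y : M).

Lemma submod0 N : is_submod N -> N 0.
Proof. by case. Qed.

Lemma submodD N x y : is_submod N -> N x -> N y -> N (x + y).
Proof. by case=> _ h _; exact: h. Qed.

Lemma submodZ N (a : Phi) x : is_submod N -> N x -> N (a *: x).
Proof. by case=> _ _; exact. Qed.

Lemma submodN N x : is_submod N -> N x -> N (- x).
Proof. by move=> hN hx; rewrite -scaleN1r; apply: submodZ. Qed.

Lemma submodB N x y : is_submod N -> N x -> N y -> N (x - y).
Proof. by move=> hN hx hy; apply: submodD => //; apply: submodN. Qed.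

Lemma submod_sum N (I : Type) (r : seq I) (P : pred I) (F : I -> M) :
  is_submod N -> (forall i, P i -> N (F i)) -> N (\sum_(i <- r | P i) F i).
Proof. by case=> h0 hD _ hF; apply: big_ind. Qed.

Lemma lspan_submod S : is_submod (lspan S).
Proof.
split=> [N [hN _]|x y hx hy N hN|a x hx N hN].
- exact: submod0.
- by apply: (submodD hN.1); [apply: hx|apply: hy].
- by apply: (submodZ _ hN.1); apply: hx.
Qed.

Lemma lspan_in S x : S x -> lspan S x.
Proof. by move=> hx N [_]; apply. Qed.

Lemma lspan_min S N : is_submod N -> S `<=` N -> lspan S `<=` N.
Proof. by move=> hN hS x; apply. Qed.

Lemma submod_preim (M' : lmodType Phi) (f : M' -> M) N :
  {morph f : u v / u + v} -> (forall a u, f (a *: u) = a *: f u) ->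
  is_submod N -> is_submod [set u | N (f u)].
Proof.
move=> fD fZ hN; split=> [|u v hu hv|a u hu] /=.
- by rewrite -(scale0r (0 : M')) fZ scale0r; exact: submod0.
- by rewrite fD; apply: submodD.
- by rewrite fZ; apply: submodZ.
Qed.

(** The shape in which the linearized Jordan identity is used modulo a submodule. *)
Lemma submod_solve1 N (a b c d e f : M) : is_submod N ->
  a + b + c = d + e + f -> N b -> N c -> N d -> N e -> N f -> N a.
Proof.
move=> hN E hb hc hd he hf.
have -> : a = d + e + f - b - c by rewrite -E; zmod.
by do !apply: submodB => //; do !apply: submodD.
Qed.

Lemma submod_solve2 N (a b c d e f : M) : is_submod N ->
  a + b + c = d + e + f -> N b -> N d -> N e -> N f -> N (a + c).
Proof.
move=> hN E hb hd he hf.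
have -> : a + c = d + e + f - b by rewrite -E; zmod.
by apply: submodB => //; do !apply: submodD.
Qed.

Lemma submod_addl N x y : is_submod N -> N (x + y) -> N y -> N x.
Proof. by move=> hN h hy; rewrite -[x](addrK y); apply: submodB. Qed.

End Submodules.

Lemma jmul_span (Phi : comPzRingType) (A : nalgType Phi) (S T N : set A) x y :
  is_submod N -> (forall x y, S x -> T y -> N (x ∘ y)) ->
  lspan S x -> lspan T y -> N (x ∘ y).
Proof.
move=> hN h hx hy.
apply: (lspan_min (N := [set x | N (x ∘ y)]) _ _ hx) => [|{}x {}hx].
  apply: submod_preim => // [a b|a b]; [exact: jmulDl|exact: jmulZl].
apply: (lspan_min (N := [set y | N (x ∘ y)]) _ _ hy) => [|{}y {}hy]; last exact: h.
by apply: submod_preim => // [a b|a b]; [exact: jmulDr|exact: jmulZr].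
Qed.

(** * The filtration of an ideal by the number of letters *)

Section Filtration.
Variables (Phi : comPzRingType) (A : nalgType Phi).
Hypothesis A_jordan : noncommutative_jordan A.
Hypothesis half_in_Phi : exists h : Phi, h *+ 2 = 1.
(* [letter w i l]: the element l is a letter of weight w and colour i. *)
Variables (n : nat) (letter : nat -> 'I_n -> A -> Prop) (e : 'I_n -> A).
Hypothesis letter_colour : forall w i l, letter w i l -> exists c, l = c *: e i.
Variable base : nat -> A -> Prop.

Definition letters (w : nat) : set A := lspan [set l | exists i, letter w i l].

Hypothesis letter_mul : forall w i l w' i' l', letter w i l -> letter w' i' l' ->
  exists a u, [/\ l ∘ l' = a + u, letters (w + w') a & base (w + w') u].

(* Elements of weight w obtained from the base by products with letters and
   with each other, a factor from the base or a letter being counted t times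
   at most; there is nothing for t = 0. *)
Inductive fil : nat -> nat -> A -> Prop :=
| fil_base w x : base w x -> fil 1 w x
| fil_zero t w : (0 < t)%N -> fil t w 0
| fil_add t w x y : fil t w x -> fil t w y -> fil t w (x + y)
| fil_scale t w a x : fil t w x -> fil t w (a *: x)
| fil_succ t w x : fil t w x -> fil t.+1 w x
| fil_letter t w x w' i l : fil t w x -> letter w' i l ->
    fil t.+1 (w + w') (x ∘ l)
| fil_mul t w x t' w' y : fil t w x -> fil t' w' y ->
    fil (t + t') (w + w') (x ∘ y).

Lemma fil_gt0 t w x : fil t w x -> (0 < t)%N.
Proof. by elim=> //= *; rewrite addn_gt0; apply/orP; left. Qed.

Lemma fil_submod t w : (0 < t)%N -> is_submod (fil t w).
Proof.
move=> ht; split; [exact: fil_zero|exact: fil_add|exact: fil_scale].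
Qed.

Lemma fil_le t t' w x : fil t w x -> (t <= t')%N -> fil t' w x.
Proof.
move=> hx; elim: t' => [|t' IH].
  by rewrite leqn0 => /eqP ht; move: (fil_gt0 hx); rewrite ht.
by rewrite leq_eqVlt => /orP[/eqP<-//|/IH/fil_succ].
Qed.

Lemma fil_cast t w x t' w' : fil t' w' x -> (t' <= t)%N -> w' = w -> fil t w x.
Proof. by move=> h1 h2 <-; apply: fil_le h2. Qed.

Lemma fil_letters t w x w' v :
  fil t w x -> letters w' v -> fil t.+1 (w + w') (x ∘ v).
Proof.
move=> hx; apply: (lspan_min (N := [set v | fil _ _ (x ∘ v)])).
  apply: submod_preim => [a b|a b|]; [exact: jmulDr|exact: jmulZr|exact: fil_submod].
by move=> l [i hl]; apply: fil_letter hl.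
Qed.

(** A product of two letters counts only once, being a combination of letters plus a base element.
    This drop makes terms containing such a product negligible. *)
Lemma fil_letter_mul t w x w1 i1 l1 w2 i2 l2 :
  fil t w x -> letter w1 i1 l1 -> letter w2 i2 l2 ->
  fil t.+1 (w + (w1 + w2)) (x ∘ (l1 ∘ l2)).
Proof.
move=> hx h1 h2; have [v [u [-> hv hu]]] := letter_mul h1 h2.
rewrite jmulDr; apply: fil_add; first exact: fil_letters.
by apply: fil_cast (fil_mul hx (fil_base hu)) _ _; lia.
Qed.

Lemma fil_letters_mul t w x w1 v w2 i2 l2 :
  fil t w x -> letters w1 v -> letter w2 i2 l2 ->
  fil t.+1 (w + (w1 + w2)) (x ∘ (v ∘ l2)).
Proof.
move=> hx h1 h2; move: v h1.
apply: (lspan_min (N := [set v | fil _ _ (x ∘ (v ∘ l2))])).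
  apply: submod_preim => [a b|a b|].
  - by rewrite jmulDl jmulDr.
  - by rewrite jmulZl jmulZr.
  - exact: fil_submod.
by move=> l [i hl] /=; apply: fil_letter_mul hx hl h2.
Qed.

Lemma fil_letter_mul3 t w x w1 i1 l1 w2 i2 l2 w3 i3 l3 :
  fil t w x -> letter w1 i1 l1 -> letter w2 i2 l2 -> letter w3 i3 l3 ->
  fil t.+2 (w + (w1 + w2 + w3)) (x ∘ ((l1 ∘ l2) ∘ l3)).
Proof.
move=> hx h1 h2 h3; have [v [u [-> hv hu]]] := letter_mul h1 h2.
rewrite jmulDl jmulDr; apply: fil_add.
  by apply: fil_cast (fil_letters_mul hx hv h3) _ _.
by apply: fil_cast (fil_mul hx (fil_letter (fil_base hu) h3)) _ _; lia.
Qed.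

(* The congruences of the proof hold modulo [dec]. *)
Inductive dec (t w : nat) : A -> Prop :=
| dec_zero : dec t w 0
| dec_add x y : dec t w x -> dec t w y -> dec t w (x + y)
| dec_scale a x : dec t w x -> dec t w (a *: x)
| dec_low t' x : fil t' w x -> (t' < t)%N -> dec t w x
| dec_mul t1 w1 x t2 w2 y : fil t1 w1 x -> fil t2 w2 y ->
    (t1 + t2 = t)%N -> (w1 + w2 = w)%N -> dec t w (x ∘ y).

Lemma dec_submod t w : is_submod (dec t w).
Proof. split; [exact: dec_zero|exact: dec_add|exact: dec_scale]. Qed.

Lemma dec_cast t w x t' w' :
  fil t' w' x -> (t' < t)%N -> w' = w -> dec t w x.
Proof. by move=> h1 h2 <-; apply: dec_low h1 h2. Qed.

(** * Congruences from the linearized Jordan identity *)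

Section Congruences.
Variables (tx wx ty wy tz wz : nat) (x y z : A).
Hypotheses (hx : fil tx wx x) (hy : fil ty wy y) (hz : fil tz wz z).
Variables (wa wb wc : nat) (i j k : 'I_n) (a b c : A).
Hypotheses (ha : letter wa i a) (hb : letter wb j b) (hc : letter wc k c).
Let JL := jordan_linearized A_jordan half_in_Phi.

(** All other terms of the linearized identity are Jordan products of two elements of the
    filtration. *)
Lemma dec_mul3_letter : dec (tx + ty + tz).+1 (wx + wy + wz + wa) (x ∘ y ∘ z ∘ a).
Proof.
apply: submod_solve1 (dec_submod _ _) (JL x z y a) _ _ _ _ _.
- by apply: dec_mul (fil_mul (fil_letter hy ha) hz) hx _ _; lia.
- by rewrite (jmulC a x); apply: dec_mul (fil_mul (fil_letter hx ha) hz) hy _ _; lia.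
- by apply: dec_mul (fil_mul hx hy) (fil_letter hz ha) _ _; lia.
- by apply: dec_mul (fil_letter hy ha) (fil_mul hz hx) _ _; lia.
- by rewrite (jmulC a x); apply: dec_mul (fil_letter hx ha) (fil_mul hz hy) _ _; lia.
Qed.

(** The two terms containing [b ∘ a] have fewer factors; the other two on the right are Jordan
    products. *)
Lemma dec_letter_swap : dec (tx + ty).+2 (wx + wy + wa + wb)
  (x ∘ b ∘ y ∘ a + x ∘ a ∘ y ∘ b).
Proof.
rewrite (jmulC x a).
apply: submod_solve2 (dec_submod _ _) (JL x y b a) _ _ _ _.
- rewrite jmulC (jmulC _ y).
  by apply: dec_cast (fil_mul hx (fil_letter_mul hy hb ha)) _ _; lia.
- by apply: dec_mul (fil_letter hx hb) (fil_letter hy ha) _ _; lia.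
- rewrite jmulC.
  by apply: dec_cast (fil_letter_mul (fil_mul hy hx) hb ha) _ _; lia.
- by rewrite (jmulC a x); apply: dec_mul (fil_letter hx ha) (fil_letter hy hb) _ _; lia.
Qed.

Lemma dec_mul_letter2 : dec (tx + ty).+2 (wx + wy + wa + wb) (x ∘ y ∘ a ∘ b).
Proof.
apply: submod_solve1 (dec_submod _ _) (JL x a y b) _ _ _ _ _.
- by apply: dec_mul (fil_letter (fil_letter hy hb) ha) hx _ _; lia.
- rewrite (jmulC b x).
  by apply: dec_mul (fil_letter (fil_letter hx hb) ha) hy _ _; lia.
- by apply: dec_cast (fil_letter_mul (fil_mul hx hy) ha hb) _ _; lia.
- rewrite (jmulC a x).
  by apply: dec_mul (fil_letter hy hb) (fil_letter hx ha) _ _; lia.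
- rewrite (jmulC b x) (jmulC a y).
  by apply: dec_mul (fil_letter hx hb) (fil_letter hy ha) _ _; lia.
Qed.

(** Every other term contains a product of two letters, so this congruence holds modulo fewer
    factors alone, without discarding Jordan products. *)
Lemma low_letter_swap : fil tx.+2 (wx + wa + wb + wc)
  (x ∘ a ∘ b ∘ c + x ∘ c ∘ b ∘ a).
Proof.
rewrite (jmulC x c).
apply: submod_solve2 (fil_submod _ _) (JL x b a c) _ _ _ _ => //.
- rewrite [_ ∘ x]jmulC.
  by apply: fil_cast (fil_letter_mul3 hx ha hc hb) _ _; lia.
- by apply: fil_cast (fil_letter_mul (fil_letter hx ha) hb hc) _ _; lia.
- rewrite (jmulC (a ∘ c)) (jmulC b).
  by apply: fil_cast (fil_letter_mul (fil_letter hx hb) ha hc) _ _; lia.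
- rewrite (jmulC c x).
  by apply: fil_cast (fil_letter_mul (fil_letter hx hc) hb ha) _ _; lia.
Qed.

End Congruences.

Lemma submod_half (N : set A) x :
  is_submod N -> N (x + x) -> N x.
Proof.
have [h hh] := half_in_Phi => hN hx.
by rewrite -[x]scale1r -hh mulr2n scalerDl -scalerDr; apply: submodZ.
Qed.

(** Letters of one colour are multiples of one element. Against skew-symmetry, this symmetry and
    [1/2] kill repeated colours. *)
Lemma same_colour_swap w a w' b i (f : A -> A -> A) :
  (forall c x y, f (c *: x) y = c *: f x y) ->
  (forall c x y, f x (c *: y) = c *: f x y) ->
  letter w i a -> letter w' i b -> f a b = f b a.
Proof.
move=> f1 f2 /letter_colour[c ->] /letter_colour[d ->].
by rewrite !(f1, f2) !scalerA mulrC.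
Qed.

Lemma low_same_colour t w x wa wb wc i j a b c : fil t w x ->
  letter wa i a -> letter wb j b -> letter wc i c ->
  fil t.+2 (w + wa + wb + wc) (x ∘ a ∘ b ∘ c).
Proof.
move=> hx ha hb hc; apply: submod_half; first exact: fil_submod.
have E : x ∘ a ∘ b ∘ c = x ∘ c ∘ b ∘ a.
  apply: (same_colour_swap (f := fun u v => x ∘ u ∘ b ∘ v) _ _ ha hc) => *.
    by rewrite jmulZr !jmulZl.
  by rewrite jmulZr.
by rewrite {2}E; exact (low_letter_swap hx ha hb hc).
Qed.

Lemma dec_same_colour tx wx x ty wy y wa wb i a b : fil tx wx x -> fil ty wy y ->
  letter wa i a -> letter wb i b ->
  dec (tx + ty).+2 (wx + wy + wa + wb) (x ∘ a ∘ y ∘ b).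
Proof.
move=> hx hy ha hb; apply: submod_half; first exact: dec_submod.
have E : x ∘ a ∘ y ∘ b = x ∘ b ∘ y ∘ a.
  apply: (same_colour_swap (f := fun u v => x ∘ u ∘ y ∘ v) _ _ ha hb) => *.
    by rewrite jmulZr !jmulZl.
  by rewrite jmulZr.
by rewrite {1}E; exact (dec_letter_swap hx hy ha hb).
Qed.

(** * Chains and trees *)

(* [chain t w cs ds x]: x is a base element multiplied successively by
   letters, whose colours, starting from the last letter, are alternately in
   cs and in ds. *)
Inductive chain : nat -> nat -> seq 'I_n -> seq 'I_n -> A -> Prop :=
| chain_base w x : base w x -> chain 1 w [::] [::] x
| chain_letter t w cs ds x w' i l : chain t w cs ds x -> letter w' i l ->
    chain t.+1 (w + w') (i :: ds) cs (x ∘ l).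

Lemma chain_fil t w cs ds x : chain t w cs ds x -> fil t w x.
Proof.
elim=> [{}w {}x /fil_base//|{}t {}w {}cs {}ds {}x w' i l _ hx hl].
exact: fil_letter hl.
Qed.

Lemma chain_size t w cs ds x :
  chain t w cs ds x -> t = (size cs + size ds).+1.
Proof. by elim=> //= {}t {}w {}cs {}ds {}x w' i l _ -> _; lia. Qed.

(** Skew-symmetry at distance two brings any colour of [cs] to the last letter and any colour of
    [ds] to the last but one. *)
Lemma chain_root t w cs ds x : chain t w cs ds x ->
  (forall i, i \in cs -> exists t' wz z wl l, [/\ t = t'.+1, (w = wz + wl)%N,
     fil t' wz z, letter wl i l & fil t' w (x - z ∘ l)]) /\
  (forall i, i \in ds -> exists t' wz z wl l wm j m,
     [/\ t = t'.+2, (w = wz + wl + wm)%N, fil t' wz z,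
      letter wl i l /\ letter wm j m & fil t'.+1 w (x - z ∘ l ∘ m)]).
Proof.
elim=> // {}t {}w {}cs {}ds {}x w' i l hx [IH1 IH2] hl.
have fx := chain_fil hx; split=> k; last first.
  move=> /IH1[t' [wz [z [wl [l' [-> -> hz hl' hxz]]]]]].
  exists t', wz, z, wl, l', w', i, l; split=> //.
  by rewrite -jmulNl -jmulDl; apply: fil_letter hxz hl.
rewrite inE => /orP[/eqP->|/IH2].
  exists t, w, x, w', l; split=> //; rewrite subrr.
  exact/fil_zero/fil_gt0/fx.
move=> [t' [wz [z [wl [l' [wm [j [m [-> -> hz [hl' hm] hxz]]]]]]]]].
(* The new last letter [l] trades places with [l'], two positions earlier, at the cost of a sign. *)
exists t'.+2, (wz + w' + wm)%N, (- (z ∘ l ∘ m)), wl, l'; split=> //.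
- by lia.
- apply: submodN; first exact: fil_submod.
  exact: fil_letter (fil_letter hz hl) hm.
have -> : x ∘ l - (- (z ∘ l ∘ m)) ∘ l' =
    (x - z ∘ l' ∘ m) ∘ l + (z ∘ l' ∘ m ∘ l + z ∘ l ∘ m ∘ l').
  by rewrite !(jmulDl, jmulNl); zmod.
apply: fil_add; first exact: fil_letter hxz hl.
exact (low_letter_swap hz hl' hm hl).
Qed.

(** A repeated colour is moved to distance two from its copy, where [low_same_colour] applies. *)
Lemma chain_dup t w cs ds x : chain t w cs ds x ->
  ~~ uniq cs || ~~ uniq ds -> exists2 t', t = t'.+1 & fil t' w x.
Proof.
elim=> // {}t {}w {}cs {}ds {}x w' i l hx IH hl.
have [cds|] := boolP (~~ uniq cs || ~~ uniq ds).
  by have [t' -> hx'] := IH cds; exists t'.+1 => //; apply: fil_letter hl.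
rewrite negb_or !negbK => /andP[ucs uds].
rewrite /= ucs uds /= andbT orbF negbK => /(chain_root hx).2.
move=> [t' [wz [z [wl [l' [wm [j [m [-> -> hz [hl' hm] hxz]]]]]]]]].
exists t'.+2 => //; have -> : x ∘ l = (x - z ∘ l' ∘ m) ∘ l + z ∘ l' ∘ m ∘ l.
  by rewrite jmulDl jmulNl; zmod.
apply: fil_add; first exact: fil_letter hxz hl.
exact: low_same_colour hz hl' hm hl.
Qed.

(** The leaves are chains and each inner node carries a letter. Only colours that can be brought to
    the root are recorded; those of [ds] stay in place, and [uniq ds] bounds their number
    instead. *)
Inductive tree : nat -> nat -> seq 'I_n -> A -> Prop :=
| tree_chain t w cs ds x : chain t w cs ds x -> uniq ds -> tree t w cs x
| tree_node t1 w1 cs1 x t2 w2 cs2 y wl i l : tree t1 w1 cs1 x ->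
    tree t2 w2 cs2 y -> letter wl i l ->
    tree (t1 + t2).+1 (w1 + w2 + wl) (i :: cs1 ++ cs2) (x ∘ y ∘ l).

Lemma tree_fil t w cs x : tree t w cs x -> fil t w x.
Proof.
elim=> [{}t {}w {}cs ds {}x /chain_fil//|t1 w1 cs1 {}x t2 w2 cs2 y wl i l].
by move=> _ hx _ hy hl; apply: fil_letter (fil_mul hx hy) hl.
Qed.

Lemma uniq_colours (cs : seq 'I_n) : uniq cs -> (size cs <= n)%N.
Proof. by move/card_uniqP<-; rewrite -[X in (_ <= X)%N]card_ord max_card. Qed.

(** A leaf has at most [n] unrecorded letters, and each node records a letter, so there are at most
    [(size cs).+1] leaves. *)
Lemma tree_size t w cs x : tree t w cs x -> (t < n.+2 * (size cs).+1)%N.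
Proof.
elim=> [{}t {}w {}cs ds {}x /chain_size-> /uniq_colours|]; first by nia.
move=> t1 w1 cs1 {}x t2 w2 cs2 y wl i l _ h1 _ h2 _.
by rewrite /= size_cat; nia.
Qed.

(** Lets subtrees be replaced modulo [dec]; the case of a Jordan product is [dec_mul3_letter]. *)
Lemma dec_node t1 w1 x t2 w2 y wl i l : dec t1 w1 x -> fil t2 w2 y ->
  letter wl i l -> dec (t1 + t2).+1 (w1 + w2 + wl) (x ∘ y ∘ l).
Proof.
move=> hx hy hl; elim: hx => {x} [|x x' _ hx _ hx'|a x _ hx|t x hx ht|].
- by rewrite !jmul0l; apply: dec_zero.
- by rewrite !jmulDl; apply: dec_add.
- by rewrite !jmulZl; apply: dec_scale.
- by apply: dec_cast (fil_letter (fil_mul hx hy) hl) _ _; lia.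
move=> t w x t' w' x' hx hx' <- <-.
exact: dec_mul3_letter hx hx' hy _ _ _ hl.
Qed.

Lemma dec_node_add t1 w1 x x' t2 w2 y wl i l : dec t1 w1 (x - x') ->
  fil t2 w2 y -> letter wl i l ->
  dec (t1 + t2).+1 (w1 + w2 + wl) (x' ∘ y ∘ l) ->
  dec (t1 + t2).+1 (w1 + w2 + wl) (x ∘ y ∘ l).
Proof.
move=> hx hy hl hx'; have -> : x ∘ y ∘ l = (x - x') ∘ y ∘ l + x' ∘ y ∘ l.
  by rewrite -!jmulDl subrK.
by apply: dec_add => //; apply: dec_node hx hy hl.
Qed.

(** By [dec_letter_swap], the letter at the root of a subtree trades places with the letter of the
    node above, so every recorded colour climbs to the top. *)
Lemma tree_root t w cs x i : tree t w cs x -> i \in cs ->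
  exists t' wz z wl l, [/\ t = t'.+1, (w = wz + wl)%N,
     fil t' wz z, letter wl i l & dec t w (x - z ∘ l)].
Proof.
move=> hx; elim: hx i => {t w cs x} [t w cs ds x hx _ i|].
  move=> /(chain_root hx).1[t' [wz [z [wl [l [-> -> hz hl hxz]]]]]].
  by exists t', wz, z, wl, l; split=> //; apply: dec_low hxz (ltnSn _).
have step t1 w1 x t2 w2 y wl j l i : fil t2 w2 y -> letter wl j l ->
    (exists t' wz z wl l, [/\ t1 = t'.+1, (w1 = wz + wl)%N,
     fil t' wz z, letter wl i l & dec t1 w1 (x - z ∘ l)]) ->
    exists t' wz z wm m, [/\ (t1 + t2).+1 = t'.+1, (w1 + w2 + wl = wz + wm)%N,
     fil t' wz z, letter wm i m
     & dec (t1 + t2).+1 (w1 + w2 + wl) (x ∘ y ∘ l - z ∘ m)].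
  move=> hy hl [t' [wz [z [wm [m [e1 e2 hz hm hxz]]]]]].
  exists (t1 + t2)%N, (wz + wl + w2)%N, (- (z ∘ l ∘ y)), wm, m; split=> //.
  - by lia.
  - apply: submodN; first by apply: fil_submod; lia.
    by apply: fil_cast (fil_mul (fil_letter hz hl) hy) _ _; lia.
  have -> : x ∘ y ∘ l - (- (z ∘ l ∘ y)) ∘ m =
      (x - z ∘ m) ∘ y ∘ l + (z ∘ m ∘ y ∘ l + z ∘ l ∘ y ∘ m).
    by rewrite !(jmulDl, jmulNl); zmod.
  apply: dec_add; first exact: dec_node hxz hy hl.
  have := dec_letter_swap hz hy hl hm.
  by rewrite e1 e2; congr (dec _ _ _); lia.
move=> t1 w1 cs1 x t2 w2 cs2 y wl j l hx IHx hy IHy hl i.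
rewrite inE mem_cat => /or3P[/eqP->|hi|hi].
- exists (t1 + t2)%N, (w1 + w2)%N, (x ∘ y), wl, l; split=> //.
    exact: fil_mul (tree_fil hx) (tree_fil hy).
  by rewrite subrr; apply: dec_zero.
- exact: step (tree_fil hy) hl (IHx _ hi).
- have := step _ _ _ _ _ _ _ _ _ _ (tree_fil hx) hl (IHy _ hi).
  by rewrite (jmulC y) (addnC t2) (addnC w2).
Qed.

Lemma tree_dup t w cs x : tree t w cs x -> ~~ uniq cs -> dec t w x.
Proof.
elim=> {t w cs x} [t w cs ds x hx _ hcs|].
  have [t' -> hx'] := chain_dup hx (introT orP (or_introl hcs)).
  exact: dec_low hx' _.
have same t1 w1 cs1 x t2 w2 y wl i l : tree t1 w1 cs1 x -> fil t2 w2 y ->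
    letter wl i l -> i \in cs1 -> dec (t1 + t2).+1 (w1 + w2 + wl) (x ∘ y ∘ l).
  move=> hx hy hl /(tree_root hx)[t' [wz [z [wm [m [e1 e2 hz hm hxz]]]]]].
  apply: (dec_node_add hxz hy hl).
  have := dec_same_colour hz hy hm hl.
  by rewrite e1 e2; congr (dec _ _ _); lia.
move=> t1 w1 cs1 x t2 w2 cs2 y wl i l hx IHx hy IHy hl.
have fx := tree_fil hx; have fy := tree_fil hy.
rewrite /= cat_uniq mem_cat !negb_and negbK -orbA => /or4P[||/IHx|].
- exact: same hx fy hl.
- by rewrite (jmulC x) (addnC t1) (addnC w1); apply: same hy fx hl.
- by move=> dx; apply: dec_node dx fy hl.
case/orP=> [|/IHy dy]; last first.
  by rewrite (jmulC x) (addnC t1) (addnC w1); apply: dec_node dy fx hl.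
(* A colour common to both subtrees is raised to the root of [x] and swapped with the node letter;
   there it meets its copy in [y]. *)
rewrite negbK => /hasP[c c2 c1].
have [t' [wz [z [wm [m [e1 e2 hz hm hxz]]]]]] := tree_root hx c1.
apply: (dec_node_add hxz fy hl).
apply: (submod_addl (dec_submod _ _) (y := z ∘ l ∘ y ∘ m)).
  have := dec_letter_swap hz fy hl hm.
  by rewrite e1 e2; congr (dec _ _ _); lia.
rewrite (jmulC _ y).
have := same _ _ _ _ _ _ _ _ _ _ hy (fil_letter hz hl) hm c2.
by rewrite e1 e2; congr (dec _ _ _); lia.
Qed.

(** * Reduction to trees and the bound on the number of factors *)

Definition red (t w : nat) : set A :=
  lspan [set x | dec t w x \/ exists cs, tree t w cs x].

Lemma red_submod t w : is_submod (red t w).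
Proof. exact: lspan_submod. Qed.

Lemma dec_red t w x : dec t w x -> red t w x.
Proof. by move=> hx; apply: lspan_in; left. Qed.

Lemma tree_red t w cs x : tree t w cs x -> red t w x.
Proof. by move=> hx; apply: lspan_in; right; exists cs. Qed.

Lemma submod_jmull (N : set A) y : is_submod N -> is_submod [set x | N (x ∘ y)].
Proof.
by apply: submod_preim => [u v|a u]; [exact: jmulDl|exact: jmulZl].
Qed.

Lemma dec_fil t w x : (0 < t)%N -> dec t w x -> fil t w x.
Proof.
move=> ht; elim=> {x} [|x y _ hx _ hy|a x _ hx|t' x hx lt|].
- exact: fil_zero.
- exact: fil_add.
- exact: fil_scale.
- by apply: fil_le hx _; lia.
by move=> t1 w1 x t2 w2 y hx hy <- <-; apply: fil_mul.
Qed.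

Lemma red_node t1 w1 x t2 w2 y wl i l : (0 < t1)%N -> (0 < t2)%N ->
  red t1 w1 x -> red t2 w2 y -> letter wl i l ->
  red (t1 + t2).+1 (w1 + w2 + wl) (x ∘ y ∘ l).
Proof.
move=> ht1 ht2 hx hy hl.
apply: (jmul_span (submod_jmull l (red_submod _ _)) _ hx hy) => {x y hx hy} x y.
move=> hx hy.
have fx : fil t1 w1 x.
  by case: hx => [/(dec_fil ht1)|[cs /tree_fil]].
case: hy => [dy|[cs2 ty]] /=.
  apply: dec_red; rewrite (jmulC x) (addnC t1) (addnC w1).
  exact: dec_node dy fx hl.
case: hx => [dx|[cs1 tx]].
  exact: dec_red (dec_node dx (tree_fil ty) hl).
exact: tree_red (tree_node tx ty hl).
Qed.

(** Extending a chain turns the old [cs] into the new [ds]; a repetition there loses a factor by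
    [chain_dup]. A letter after a node falls under [dec_mul_letter2]. *)
Lemma red_tree_letter t w cs x w' i l : tree t w cs x -> letter w' i l ->
  red t.+1 (w + w') (x ∘ l).
Proof.
case=> {t w cs x} [t w cs ds x hx uds|t1 w1 cs1 x t2 w2 cs2 y wm j m hx hy hm] hl.
  have hxl := chain_letter hx hl.
  have [ucs|ncs] := boolP (uniq cs); first exact: tree_red (tree_chain hxl ucs).
  have [|t' [->] hx'] := chain_dup hxl; first by rewrite ncs orbT.
  by apply: dec_red; apply: dec_low hx' (ltnSn _).
exact: dec_red (dec_mul_letter2 (tree_fil hx) (tree_fil hy) hm hl).
Qed.

Lemma fil_red t w x : fil t w x -> red t w x.
Proof.
elim/ltn_ind: t w x => t0 IH w x hx.
elim: hx IH => {t0 w x} [w x hx _|t w ht _|t w x y _ hx _ hy IH|t w a x _ hx IH|||].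
- exact: tree_red (tree_chain (chain_base hx) _).
- exact: submod0 (red_submod _ _).
- by apply: (submodD (red_submod _ _)); [apply: hx|apply: hy].
- by apply: (submodZ _ (red_submod _ _)); apply: hx.
- by move=> t w x hx _ _; apply: dec_red; apply: dec_low hx (ltnSn _).
- move=> t w x w' i l hx _ hl IH.
  have := IH t (ltnSn t) w x hx; move: x {hx}.
  apply: lspan_min; first exact/submod_jmull/red_submod.
  move=> x /= [|[cs tx]]; last exact: red_tree_letter tx hl.
  elim=> {x} [|x y _ hx _ hy|a x _ hx|t' x hx ht|].
  + by rewrite jmul0l; apply: submod0 (red_submod _ _).
  + by rewrite jmulDl; apply: (submodD (red_submod _ _)).
  + by rewrite jmulZl; apply: (submodZ _ (red_submod _ _)).
  + by apply: dec_red; apply: dec_low (fil_letter hx hl) _.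
  (* A Jordan product times a letter becomes a node once both factors are reduced; being shorter,
     they fall under the outer induction. *)
  move=> t1 w1 x t2 w2 y hx hy et ew.
  have t1_gt0 := fil_gt0 hx; have t2_gt0 := fil_gt0 hy.
  rewrite -et -ew; apply: (red_node _ _ _ _ hl) => //.
    by apply: IH hx; lia.
  by apply: IH hy; lia.
- by move=> t w x t' w' y hx _ hy _ _; apply: dec_red; apply: dec_mul hx hy _ _.
Qed.

(** Distinct recorded colours number at most [n], so by [tree_size] such a tree has fewer than
    [n.+2 * n.+1] factors. *)
Lemma fil_dec t w x : fil t w x -> (n.+2 * n.+1 <= t)%N -> dec t w x.
Proof.
move=> /fil_red hx ht; move: x hx; apply: lspan_min; first exact: dec_submod.
move=> x [//|[cs tx]]; have [ucs|] := boolP (uniq cs); last exact: tree_dup tx.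
by have := tree_size tx; have := uniq_colours ucs; nia.
Qed.

(** By [fil_dec], long elements are combinations of shorter ones and of Jordan products of shorter
    ones. *)
Lemma fil_ind_bounded (Y : nat -> set A) :
  (forall w, is_submod (Y w)) ->
  (forall t w x, (t < n.+2 * n.+1)%N -> fil t w x -> Y w x) ->
  (forall w x w' y, Y w x -> Y w' y -> Y (w + w')%N (x ∘ y)) ->
  forall t w x, fil t w x -> Y w x.
Proof.
move=> hY Yfil Ymul t; elim/ltn_ind: t => t IH w x hx.
case: (ltnP t (n.+2 * n.+1)) => ht; first exact: Yfil ht hx.
elim: (fil_dec hx ht) => {x hx} [|x y _ hx _ hy|a x _ hx|t' x hx lt|].
- exact: submod0.
- exact: submodD.
- exact: submodZ.
- exact: IH hx.
move=> t1 w1 x t2 w2 y hx hy et <-.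
have t1_gt0 := fil_gt0 hx; have t2_gt0 := fil_gt0 hy.
by apply: Ymul; [apply: IH hx; lia|apply: IH hy; lia].
Qed.

End Filtration.

(** * The relatively free algebra *)

Local Notation npoly := Defs.npoly.

Section LinearExtension.
Variables (Phi : comPzRingType) (M : lmodType Phi).
Implicit Types (phi : word -> M) (f g : npoly Phi).

Definition npoly_lin phi f : M := \sum_(w <- msupp f) f@_w *: phi w.

Lemma npoly_linEw (d : {fset word}) phi f :
  (msupp f `<=` d)%fset -> npoly_lin phi f = \sum_(w <- d) f@_w *: phi w.
Proof.
move=> hd; apply: big_fset_incl => // w _ /mcoeff_outdom->.
by rewrite scale0r.
Qed.

Lemma npoly_linD phi f g : npoly_lin phi (f + g) = npoly_lin phi f + npoly_lin phi g.
Proof.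
rewrite (npoly_linEw phi (msuppD_le f g)) (npoly_linEw phi (fsubsetUl _ (msupp g))).
rewrite (npoly_linEw phi (fsubsetUr (msupp f) _)) -big_split /=.
by apply: eq_bigr => w _; rewrite mcoeffD scalerDl.
Qed.

Lemma npoly_linU phi (a : Phi) w : npoly_lin phi << a *g w >> = a *: phi w.
Proof. by rewrite (npoly_linEw phi msuppU_le) big_seq_fset1 mcoeffUU. Qed.

Lemma eq_npoly_lin phi psi f : phi =1 psi -> npoly_lin phi f = npoly_lin psi f.
Proof. by move=> h; apply: eq_bigr => w _; rewrite h. Qed.

Lemma npoly_lin_add phi psi f :
  npoly_lin (fun w => phi w + psi w) f = npoly_lin phi f + npoly_lin psi f.
Proof. by rewrite -big_split /=; apply: eq_bigr => w _; rewrite scalerDr. Qed.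

Lemma npoly_lin_scale phi (a : Phi) f :
  npoly_lin (fun w => a *: phi w) f = a *: npoly_lin phi f.
Proof. by rewrite scaler_sumr; apply: eq_bigr => w _; rewrite !scalerA mulrC. Qed.

End LinearExtension.

Section FreeAlgebra.
Variable Phi : comPzRingType.

(* [npoly Phi] with the module structure that monalg provides only over
   nontrivial rings, and with the product of the free algebra. *)
Definition freealg := npoly Phi.

HB.instance Definition _ := GRing.Zmodule.on freealg.

Definition free_scale (a : Phi) (f : freealg) : freealg :=
  [malg w in msupp f => a * f@_w].

Lemma free_scaleE a f w : (free_scale a f)@_w = a * f@_w.
Proof. by rewrite mcoeffE; case: msuppP; rewrite ?mulr0. Qed.

Lemma free_scaleA a b f : free_scale a (free_scale b f) = free_scale (a * b) f.
Proof. by apply/malgP=> w; rewrite !free_scaleE mulrA. Qed.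

Lemma free_scale1 : left_id 1 free_scale.
Proof. by move=> f; apply/malgP=> w; rewrite free_scaleE mul1r. Qed.

Lemma free_scaleDr : right_distributive free_scale +%R.
Proof.
by move=> a f g; apply/malgP=> w; rewrite mcoeffD !free_scaleE mcoeffD mulrDr.
Qed.

Lemma free_scaleDl f : {morph free_scale^~ f : a b / a + b}.
Proof.
by move=> a b; apply/malgP=> w; rewrite mcoeffD !free_scaleE mulrDl.
Qed.

HB.instance Definition _ := GRing.Zmodule_isLmodule.Build Phi freealg
  free_scaleA free_scale1 free_scaleDr free_scaleDl.

Lemma npoly_linZ (M : lmodType Phi) (phi : word -> M) (a : Phi) (f : freealg) :
  npoly_lin phi (a *: f) = a *: npoly_lin phi f.
Proof.
have hs : (msupp (free_scale a f) `<=` msupp f)%fset.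
  apply/fsubsetP=> w; rewrite -!mcoeff_neq0 free_scaleE.
  by apply: contra_neq => ->; rewrite mulr0.
rewrite (npoly_linEw phi hs) scaler_sumr; apply: eq_bigr => w _.
by rewrite free_scaleE scalerA.
Qed.

Definition mon (w : word) : freealg := << 1 *g w >>.

Lemma npoly_lin_mon (M : lmodType Phi) (phi : word -> M) w :
  npoly_lin phi (mon w) = phi w.
Proof. by rewrite npoly_linU scale1r. Qed.

Lemma scale_mon (a : Phi) w : a *: mon w = << a *g w >>.
Proof.
by apply/malgP => u; rewrite free_scaleE !mcoeffU mulrnAr mulr1.
Qed.

Lemma npoly_linK (f : freealg) : npoly_lin mon f = f.
Proof.
rewrite [RHS]monalgE; apply: eq_bigr => w _; exact: scale_mon.
Qed.

Lemma free_ind (N : set freealg) :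
  is_submod N -> (forall w, N (mon w)) -> forall f, N f.
Proof.
move=> hN h f; rewrite -(npoly_linK f).
by apply: submod_sum => // w _; apply: submodZ.
Qed.

Definition free_mul (f g : freealg) : freealg :=
  npoly_lin (fun u => npoly_lin (fun v => mon (Mul u v)) g) f.

Lemma free_mulDl : left_distributive free_mul +%R.
Proof. by move=> f g h; rewrite /free_mul npoly_linD. Qed.

Lemma free_mulDr : right_distributive free_mul +%R.
Proof.
move=> f g h; rewrite /free_mul -npoly_lin_add.
by apply: eq_npoly_lin => u; rewrite npoly_linD.
Qed.

Lemma free_mulZl (a : Phi) f g : free_mul (a *: f) g = a *: free_mul f g.
Proof. by rewrite /free_mul npoly_linZ. Qed.

Lemma free_mulZr (a : Phi) f g : free_mul f (a *: g) = a *: free_mul f g.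
Proof.
rewrite /free_mul -npoly_lin_scale.
by apply: eq_npoly_lin => u; rewrite npoly_linZ.
Qed.

HB.instance Definition _ := Lmodule_isNAlgebra.Build Phi freealg
  free_mulDl free_mulDr free_mulZl free_mulZr.

Lemma mon_mul u v : mon u ** mon v = mon (Mul u v).
Proof. by rewrite /nmul /= /free_mul !npoly_lin_mon. Qed.

End FreeAlgebra.

Section Evaluation.
Variables (Phi : comPzRingType) (A : nalgType Phi) (v : nat -> A).
Implicit Types f g : freealg Phi.

Lemma npoly_evalD f g : npoly_eval v (f + g) = npoly_eval v f + npoly_eval v g.
Proof. exact: npoly_linD. Qed.

Lemma npoly_evalZ a f : npoly_eval v (a *: f) = a *: npoly_eval v f.
Proof. exact: npoly_linZ. Qed.

Lemma npoly_eval0 : npoly_eval v (0 : freealg Phi) = 0.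
Proof. by rewrite -(scale0r (0 : freealg Phi)) npoly_evalZ scale0r. Qed.

Lemma npoly_eval_mon w : npoly_eval v (mon Phi w) = word_eval v w.
Proof. exact: npoly_lin_mon. Qed.

Lemma npoly_evalM f g : npoly_eval v (f ** g) = npoly_eval v f ** npoly_eval v g.
Proof.
move: f; apply: free_ind => [|u /=].
  split=> /= [|f h hf hh|a f hf].
  - by rewrite nmul0l npoly_eval0 nmul0l.
  - by rewrite nmulDl !npoly_evalD hf hh nmulDl.
  - by rewrite nmulZl !npoly_evalZ hf nmulZl.
move: g; apply: free_ind => [|w /=]; last by rewrite mon_mul !npoly_eval_mon.
split=> /= [|f h hf hh|a f hf].
- by rewrite nmul0r npoly_eval0 nmul0r.
- by rewrite nmulDr !npoly_evalD hf hh nmulDr.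
- by rewrite nmulZr !npoly_evalZ hf nmulZr.
Qed.

End Evaluation.

(** * Homomorphisms and quotients *)

Section Homomorphisms.
Variables (Phi : comPzRingType) (A B : nalgType Phi) (f : A -> B).
Hypotheses (fD : {morph f : x y / x + y}) (fZ : forall a x, f (a *: x) = a *: f x).
Hypothesis fM : {morph f : x y / x ** y}.

Lemma hom0 : f 0 = 0.
Proof. by rewrite -(scale0r (0 : A)) fZ scale0r. Qed.

Lemma hom_word v w : f (word_eval v w) = word_eval (f \o v) w.
Proof. by elim: w => //= w1 IH1 w2 IH2; rewrite fM IH1 IH2. Qed.

Lemma hom_npoly v (p : freealg Phi) : f (npoly_eval v p) = npoly_eval (f \o v) p.
Proof.
rewrite /npoly_eval (big_morph f fD hom0); apply: eq_bigr => w _.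
by rewrite fZ hom_word.
Qed.

Lemma hom_in_variety V : (forall y, exists x, f x = y) ->
  in_variety V A -> in_variety V B.
Proof.
move=> fsurj hA p hp v.
have [u hu] := choice (fun i => fsurj (v i)).
have -> : v = f \o u by apply: funext => i /=; rewrite hu.
by rewrite -(hom_npoly u p) hA // hom0.
Qed.

End Homomorphisms.

Section Quotients.
Variables (Phi : comPzRingType) (A : nalgType Phi) (I : ideal A).

Definition proj (x : A) : quot_alg I := \pi_(quot_alg I)%qT x.

Lemma projD : {morph proj : x y / x + y}.
Proof. exact: quot_alg_piD. Qed.

Lemma projZ a x : proj (a *: x) = a *: proj x.
Proof. exact: quot_alg_piZ. Qed.

Lemma projM : {morph proj : x y / x ** y}.
Proof. by move=> x y; rewrite /proj -quot_mul_pi. Qed.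

Lemma proj_surj y : exists x, proj x = y.
Proof. by exists (repr y); apply: reprK. Qed.

Lemma proj_eq x y : proj x = proj y <-> ideal_set I (x - y).
Proof. exact: quot_algE. Qed.

Lemma proj_eq0 x : proj x = 0 <-> ideal_set I x.
Proof. by rewrite -(hom0 projZ) proj_eq subr0. Qed.

Lemma quot_in_variety V : in_variety V A -> in_variety V (quot_alg I).
Proof. exact: hom_in_variety projD projZ projM V proj_surj. Qed.

End Quotients.

(** * Products of many elements *)

Section Products.
Variables (Phi : comPzRingType) (A : nalgType Phi).
Implicit Types (B : set A) (s : seq A).

Lemma nprod_gt0 B t x : nprod B t x -> (0 < t)%N.
Proof. by elim=> // p q *; rewrite addn_gt0; apply/orP; left. Qed.

Lemma nprod_sub B C t : B `<=` C -> nprod B t `<=` nprod C t.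
Proof.
move=> hBC x; elim=> [{}x /hBC|p q {}x y _ hx _ hy]; first exact: NProd1.
exact: NProdM.
Qed.

Lemma nprod_subalg B t x : is_subalg B -> nprod B t x -> B x.
Proof. by case=> _ hB; elim=> // p q {}x y _ hx _; apply: hB. Qed.

Lemma nprod_le B t m x :
  is_subalg B -> nprod B t x -> (0 < m <= t)%N -> nprod B m x.
Proof.
move=> hB hx; elim: hx m => {t x} [x hx|p q x y hx IHx hy IHy] m /andP[m0 mt].
  have -> : m = 1%N by lia.
  exact: NProd1.
have p0 := nprod_gt0 hx; have q0 := nprod_gt0 hy.
case: (ltnP 1 m) => m1.
  (* The predecessor leaves at least one factor for [y]. *)
  have -> : m = (minn p m.-1 + (m - minn p m.-1))%N by lia.
  by apply: NProdM; [apply: IHx|apply: IHy]; lia.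
have -> : m = 1%N by lia.
by apply: NProd1; apply: hB.2; [exact: nprod_subalg hx|exact: nprod_subalg hy].
Qed.

Lemma subalg_genP s : is_subalg (subalg_gen [set` s]).
Proof.
split; first split=> [B [[hB _] _]|x y hx hy B hB|a x hx B hB].
- exact: submod0.
- by apply: (submodD hB.1.1); [apply: hx|apply: hy].
- by apply: (submodZ _ hB.1.1); apply: hx.
by move=> x y hx hy B hB; apply: hB.1.2; [apply: hx|apply: hy].
Qed.

Lemma subalg_gen_in s x : x \in s -> subalg_gen [set` s] x.
Proof. by move=> hx B [_]; apply. Qed.

Lemma subalg_gen_min s B : is_subalg B -> [set` s] `<=` B ->
  subalg_gen [set` s] `<=` B.
Proof. by move=> hB hs x; apply. Qed.

Lemma nprod_word s t x : nprod [set` s] t x ->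
  exists w, [/\ size (leaves w) = t, all (ltn^~ (size s)) (leaves w)
    & word_eval (nth 0 s) w = x].
Proof.
elim=> [{}x /= xs|p q {}x y _ [u [su lu eu]] _ [w [sw lw ew]]].
  by exists (Var (index x s)); split=> //=; rewrite ?index_mem ?xs // nth_index.
exists (Mul u w); split=> /=; first by rewrite size_cat su sw.
  by rewrite all_cat lu.
by rewrite eu ew.
Qed.

Lemma word_nprod s w : all (ltn^~ (size s)) (leaves w) ->
  nprod [set` s] (size (leaves w)) (word_eval (nth 0 s) w).
Proof.
elim: w => [i|u IHu w IHw] /=.
  by rewrite andbT => hi; apply: NProd1 => /=; apply: mem_nth.
by rewrite all_cat size_cat => /andP[/IHu hu /IHw hw]; apply: NProdM.
Qed.

End Products.

(** * Long products are Jordan decomposable *)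

Section JordanSquare.
Variables (Phi : comPzRingType) (A : nalgType Phi).
Hypothesis half_in_Phi : exists h : Phi, h *+ 2 = 1.
Hypothesis A_jordan : noncommutative_jordan A.

Definition jsquare : set A := lspan [set z | exists x y, z = x ∘ y].

Lemma jsquare_jmul x y : jsquare (x ∘ y).
Proof. by apply: lspan_in; exists x, y. Qed.

(** Twice a product is a Jordan product plus or minus a commutator, and commutators preserve
    [jsquare] by the derivation rule. *)
Lemma jsquare_ideal : is_ideal jsquare.
Proof.
have hJ : is_submod jsquare by exact: lspan_submod.
split=> // z u hz.
have hb : jsquare (bracket z u).
  move: z hz; apply: (lspan_min (N := [set z | jsquare (bracket z u)])).
    apply: submod_preim => // [a b|a b]; rewrite /bracket.
      by rewrite nmulDl nmulDr; zmod.
    by rewrite nmulZl nmulZr scalerBr.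
  move=> _ [x [y ->]] /=; rewrite bracket_jmul //.
  by apply: (submodD hJ); exact: jsquare_jmul.
have hj := jsquare_jmul z u.
split; apply: (submod_half half_in_Phi hJ).
  have -> : z ** u + z ** u = z ∘ u + bracket z u.
    by rewrite jmulE /bracket; zmod.
  exact: (submodD hJ).
have -> : u ** z + u ** z = z ∘ u - bracket z u.
  by rewrite jmulE /bracket; zmod.
exact: (submodB hJ).
Qed.

Lemma jsquare_anticommutative : anticommutative (quot_alg (Ideal jsquare_ideal)).
Proof.
move=> x y; have [a <-] := proj_surj x; have [b <-] := proj_surj y.
apply/eqP; rewrite -addr_eq0; apply/eqP.
rewrite -!projM -projD; apply/proj_eq0 => /=.
by rewrite -jmulE; apply: jsquare_jmul.
Qed.

End JordanSquare.

(** * Transfer from the relatively free algebra by homogeneity *)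

Section RelativelyFree.
Variables (Phi : comPzRingType) (V : variety Phi).

(** The T-ideal of the variety. *)
Definition identities : set (freealg Phi) := fun f => holds_in_variety V f.

Lemma identities_ideal : is_ideal identities.
Proof.
split; first split.
- by move=> A hA v; rewrite npoly_eval0.
- by move=> f g hf hg A hA v; rewrite npoly_evalD hf // hg // addr0.
- by move=> a f hf A hA v; rewrite npoly_evalZ hf // scaler0.
move=> f g hf; split=> A hA v.
  by rewrite npoly_evalM hf // nmul0l.
by rewrite npoly_evalM hf // nmul0r.
Qed.

Definition relfree := quot_alg (Ideal identities_ideal).

(** Substituting polynomials into an identity gives an identity, since evaluating the result is
    evaluating the original at the evaluated polynomials. *)
Lemma relfree_in_variety : in_variety V relfree.
Proof.
move=> p hp v.
have [u hu] := choice (fun i => proj_surj (v i)).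
have -> : v = proj (Ideal identities_ideal) \o u by apply: funext => i /=; rewrite hu.
rewrite -(hom_npoly (@projD _ _ _) (@projZ _ _ _) (@projM _ _ _)).
apply/proj_eq0 => A hA w /=.
rewrite (hom_npoly (A := freealg Phi) (f := npoly_eval w)) ?hA //.
- exact: npoly_evalD.
- exact: npoly_evalZ.
- exact: npoly_evalM.
Qed.

Section Decomposition.
Variables (A : nalgType Phi) (s : seq A).
Hypothesis A_in : in_variety V A.
Hypothesis V_homogeneous : homogeneous_variety V.

Definition jdec (t : nat) : set A := lspan [set z | exists i j x y,
  [/\ (i + j)%N = t, nprod [set` s] i x, nprod [set` s] j y & z = x ∘ y]].

Lemma homogeneous_componentE c (f : freealg Phi) : homogeneous_component c f =
  npoly_lin (fun w => if perm_eq (leaves w) c then mon Phi w else 0) f.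
Proof.
rewrite /homogeneous_component big_mkcond /=; apply: eq_bigr => w _.
by case: ifP => _; rewrite ?scaler0 // scale_mon.
Qed.

(** Stated on components so that the multidegree controls the number of generators in each Jordan
    product. *)
Definition decomposable (f : freealg Phi) : Prop :=
  forall c, all (ltn^~ (size s)) c ->
    jdec (size c) (npoly_eval (nth 0 s) (homogeneous_component c f)).

Lemma decomposable_submod : is_submod decomposable.
Proof.
have hE c f : npoly_eval (nth 0 s) (homogeneous_component c f) =
    npoly_eval (nth 0 s) (npoly_lin (fun w => if perm_eq (leaves w) c
      then mon Phi w else 0) f) by rewrite homogeneous_componentE.
split=> [c hc|f g hf hg c hc|a f hf c hc].
- rewrite hE -(scale0r (0 : freealg Phi)) npoly_linZ npoly_evalZ scale0r.
  exact: submod0 (lspan_submod _).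
- rewrite hE npoly_linD npoly_evalD -!hE.
  by apply: (submodD (lspan_submod _)); [apply: hf|apply: hg].
- rewrite hE npoly_linZ npoly_evalZ -!hE.
  by apply: (submodZ _ (lspan_submod _)); apply: hf.
Qed.

Lemma decomposable_identity f : identities f -> decomposable f.
Proof.
move=> hf c hc; rewrite (V_homogeneous hf c A_in).
exact: submod0 (lspan_submod _).
Qed.

Lemma decomposable_jmul (f g : freealg Phi) : decomposable (f ∘ g).
Proof.
have hN h : is_submod [set f | decomposable (f ∘ h)].
  exact: submod_jmull decomposable_submod.
move: f; apply: (free_ind (hN g)) => u /=; rewrite jmulC.
move: g; apply: (free_ind (hN _)) => w /=.
rewrite jmulE !mon_mul => c hc.
rewrite homogeneous_componentE npoly_linD !npoly_lin_mon /= perm_catC.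
case: ifP => hp; last by rewrite addr0 npoly_eval0; apply: submod0 (lspan_submod _).
have := hc; rewrite -(perm_all _ hp) all_cat => /andP[hu hw].
rewrite npoly_evalD !npoly_eval_mon /= -jmulE; apply: lspan_in.
exists (size (leaves w)), (size (leaves u)).
exists (word_eval (nth 0 s) w), (word_eval (nth 0 s) u).
by split=> //; [rewrite -(perm_size hp) size_cat addnC|exact: word_nprod..].
Qed.

(** Two lifts of one element differ by an identity, which is decomposable, so it suffices to treat
    Jordan products of lifts. *)
Lemma jsquare_decomposable (f : freealg Phi) :
  jsquare (A := relfree) (proj _ f) -> decomposable f.
Proof.
have hD := decomposable_submod.
pose N : set relfree := fun y =>
  forall f, proj (Ideal identities_ideal) f = y -> decomposable f.
suff : jsquare (A := relfree) `<=` N by move=> h /h; apply.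
have lift g h : proj (Ideal identities_ideal) g = proj _ h ->
    decomposable h -> decomposable g.
  move=> /proj_eq /= hgh hh; rewrite -[g](subrK h).
  by apply: (submodD hD) => //; apply: decomposable_identity.
apply: lspan_min.
  split.
  - move=> g hg; apply: (lift g (0 : freealg Phi)); last exact: (submod0 hD).
    by rewrite hg (hom0 (@projZ _ _ _)).
  - move=> x y hx hy g hg.
    have [a ea] := proj_surj x; have [b eb] := proj_surj y.
    apply: (lift g (a + b)); first by rewrite hg projD ea eb.
    by apply: (submodD hD) => //; [apply: hx|apply: hy].
  - move=> a x hx g hg; have [b eb] := proj_surj x.
    apply: (lift g (a *: b)); first by rewrite hg projZ eb.
    by apply: (submodZ _ hD) => //; apply: hx.
move=> _ [x [y ->]] g hg.
have [a ea] := proj_surj x; have [b eb] := proj_surj y.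
apply: (lift g (a ∘ b)); last exact: decomposable_jmul.
by rewrite hg !jmulE projD !projM ea eb.
Qed.

End Decomposition.

(** The bound depends only on [k]: it is a nilpotency exponent for the images of [k] variables in
    the relatively free algebra modulo its Jordan square. *)
Lemma long_product_jdec : (exists h : Phi, h *+ 2 = 1) ->
  homogeneous_variety V -> noncommutative_jordan_variety V ->
  locally_admissible V ->
  forall k, exists2 N, (0 < N)%N & forall (A : nalgType Phi) (s : seq A),
    in_variety V A -> size s = k -> forall t x, (N <= t)%N ->
    nprod [set` s] t x -> jdec s t x.
Proof.
move=> half V_hom V_jor V_adm k.
pose J_id := jsquare_ideal half (V_jor _ relfree_in_variety).
pose Q := quot_alg (Ideal J_id).
pose p : freealg Phi -> Q := fun f => proj (Ideal J_id) (proj (Ideal identities_ideal) f).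
have pM : {morph p : x y / x ** y} by move=> x y; rewrite /p !projM.
have hQ : in_variety V Q by apply: quot_in_variety relfree_in_variety.
pose s0 : seq Q := [seq p (mon Phi (Var i)) | i <- iota 0 k].
have Q_anti : anticommutative Q by exact: jsquare_anticommutative.
have [m m0 hm] := V_adm Q hQ Q_anti s0 (fun _ _ => I).
exists m => // A s hA hs t x hmt /nprod_word[w [sw lw <-]].
rewrite hs in lw.
have hp u : all (ltn^~ k) (leaves u) -> nprod [set` s0] (size (leaves u)) (p (mon Phi u)).
  elim: u => [i|u IHu v IHv] /=.
    by rewrite andbT => ik; apply: NProd1 => /=; apply: map_f; rewrite mem_iota.
  rewrite all_cat size_cat => /andP[/IHu hu /IHv hv].
  by rewrite -mon_mul pM; apply: NProdM.
have hw : p (mon Phi w) = 0.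
  apply: hm; apply: lspan_in.
  apply: (nprod_le (t := t)); first exact: subalg_genP.
    rewrite -sw; apply: nprod_sub (hp _ lw) => z; exact: subalg_gen_in.
  by rewrite m0.
have hd : decomposable s (mon Phi w).
  by apply: (jsquare_decomposable hA V_hom); move: hw => /proj_eq0.
(* A monomial is its own component in the multidegree [leaves w]. *)
have := hd (leaves w).
rewrite hs lw sw homogeneous_componentE npoly_lin_mon perm_refl npoly_eval_mon.
exact.
Qed.

End RelativelyFree.

(** * Extensions of locally finite algebras *)

Section Scalars.
Variables (Phi : comPzRingType) (Z : set Phi).
Hypothesis Z_ideal : is_submod (Z : set Phi^o).

Lemma scalar_mul a c : Z c -> Z (a * c).
Proof. by move=> hc; have := submodZ a Z_ideal hc. Qed.

Section ModuleSpan.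
Variable M : lmodType Phi.

Definition scalar_span (E : set M) : set M :=
  lspan [set x | exists c y, [/\ Z c, E y & x = c *: y]].

Lemma scalar_span_submod E : is_submod (scalar_span E).
Proof. exact: lspan_submod. Qed.

Lemma scalar_span_scale E c y : Z c -> lspan E y -> scalar_span E (c *: y).
Proof.
move=> hc; move: y.
apply: (lspan_min (N := [set y | scalar_span E (c *: y)])) => [|y hy].
  apply: submod_preim => [u v|a u|]; [exact: scalerDr| |exact: lspan_submod].
  by rewrite !scalerA mulrC.
by apply: lspan_in; exists c, y.
Qed.

Lemma scalar_span_sub E F : E `<=` lspan F -> scalar_span E `<=` scalar_span F.
Proof.
move=> hEF; apply: lspan_min; first exact: lspan_submod.
by move=> _ [c [y [hc /hEF hy ->]]]; apply: scalar_span_scale.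
Qed.

Lemma Zspan_scalar_span n (a : 'I_n -> M) E :
  (forall i, lspan E (a i)) -> Zspan Z a `<=` scalar_span E.
Proof.
move=> ha _ [z hz ->]; apply: submod_sum; first exact: lspan_submod.
by move=> i _; apply: scalar_span_scale.
Qed.

Lemma Zspan_submod n (a : 'I_n -> M) : is_submod (Zspan Z a).
Proof.
split=> [|_ _ [z hz ->] [z' hz' ->]|c _ [z hz ->]].
- exists (fun=> 0) => [_|]; first exact: (submod0 Z_ideal).
  by rewrite big1 // => i _; rewrite scale0r.
- exists (fun i => z i + z' i) => [i|]; first exact: (submodD Z_ideal).
  by rewrite -big_split; apply: eq_bigr => i _; rewrite scalerDl.
- exists (fun i => c * z i) => [i|]; first exact: scalar_mul.
  by rewrite scaler_sumr; apply: eq_bigr => i _; rewrite scalerA.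
Qed.

Lemma scalar_span_Zspan (s : seq M) :
  scalar_span [set` s] `<=` Zspan Z (fun i : 'I_(size s) => s`_i).
Proof.
apply: lspan_min; first exact: Zspan_submod.
move=> _ [c [y [hc /= hy ->]]].
have hi : (index y s < size s)%N by rewrite index_mem.
exists (fun i => if i == Ordinal hi then c else 0) => [i|].
  by case: ifP => _ //; apply: (submod0 Z_ideal).
rewrite (bigD1 (Ordinal hi)) //= eqxx nth_index // big1 ?addr0 // => i.
by move=> /negbTE->; rewrite scale0r.
Qed.

End ModuleSpan.

(** * Weights that are raised at the price of a coefficient from [Z] *)

Section Penalized.
Variable A : nalgType Phi.
Implicit Types P Q R : nat -> A -> Prop.

(* Raising the weight of an element costs a coefficient from Z. *)
Definition penalized P (w : nat) : set A :=
  lspan [set x | P w x \/ exists v y c, [/\ P v y, (v < w)%N, Z c & x = c *: y]].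

Lemma penalized_submod P w : is_submod (penalized P w).
Proof. exact: lspan_submod. Qed.

Lemma penalized_in P w x : P w x -> penalized P w x.
Proof. by move=> hx; apply: lspan_in; left. Qed.

Lemma penalized_raise P v w c x :
  penalized P v x -> (v < w)%N -> Z c -> penalized P w (c *: x).
Proof.
move=> hx hvw hc; move: x hx.
apply: (lspan_min (N := [set x | penalized P w (c *: x)])).
  apply: submod_preim => [a b|a x|]; [exact: scalerDr| |exact: lspan_submod].
  by rewrite !scalerA mulrC.
move=> x [hx|[v' [y [d [hy hv' hd ->]]]]]; apply: lspan_in; right.
  by exists v, x, c.
exists v', y, (c * d); split=> //; [exact: ltn_trans hvw|exact: scalar_mul|].
by rewrite scalerA.
Qed.

Lemma penalized_min P w (N : set A) : is_submod N -> P w `<=` N ->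
  (forall v y c, P v y -> (v < w)%N -> Z c -> N (c *: y)) ->
  penalized P w `<=` N.
Proof.
move=> hN h1 h2; apply: lspan_min => // x [/h1//|[v [y [c [hy hv hc ->]]]]].
exact: h2 hv hc.
Qed.

Lemma penalized_sub P Q w : (forall v x, P v x -> Q v x) ->
  penalized P w `<=` penalized Q w.
Proof.
move=> h; apply: penalized_min => [|x /h|v y c /h hy hv hc].
- exact: penalized_submod.
- exact: penalized_in.
- by apply: penalized_raise hc; first exact: penalized_in hy.
Qed.

Lemma penalized_mul P Q R : (forall v x w y, P v x -> Q w y ->
    penalized R (v + w) (x ∘ y)) ->
  forall v x w y, penalized P v x -> penalized Q w y ->
    penalized R (v + w) (x ∘ y).
Proof.
move=> h v x w y hx hy.
apply: (jmul_span (penalized_submod R _) _ hx hy) => {hx hy}{}x {}y.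
case=> [hx|[v' [x' [c [hx hv hc ->]]]]]; case=> [hy|[w' [y' [d [hy hw hd ->]]]]].
- exact: h.
- rewrite jmulZr; apply: penalized_raise hd; first exact: h hx hy.
  by rewrite ltn_add2l.
- rewrite jmulZl; apply: penalized_raise hc; first exact: h hx hy.
  by rewrite ltn_add2r.
rewrite jmulZl jmulZr; apply: penalized_raise hc.
  by apply: (submodZ d (penalized_submod _ _)); apply: h hx hy.
by lia.
Qed.

End Penalized.
End Scalars.

(** * Words in the generators *)

Section Words.
Variables (Phi : comPzRingType) (A : nalgType Phi).
Implicit Types (s : seq A).

(** Here [n] bounds the depth of the words; this catches all products of at most [n] factors, but
    also some longer ones. *)
Fixpoint words s (n : nat) : seq (nat * A) :=
  if n is n'.+1 then [seq (1, x)%N | x <- s] ++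
    [seq ((p.1 + q.1)%N, p.2 ** q.2) | p <- words s n', q <- words s n']
  else [::].

Lemma words_complete s n t x :
  nprod [set` s] t x -> (t <= n)%N -> (t, x) \in words s n.
Proof.
move=> hx; elim: hx n => {t x} [x hx|p q x y hx IHx hy IHy] [|n] //=.
- by move=> _; rewrite mem_cat; apply/orP; left; apply: map_f.
- by have := nprod_gt0 hx; lia.
move=> hn; have hp := nprod_gt0 hx; have hq := nprod_gt0 hy.
rewrite mem_cat; apply/orP; right.
have hx' : (p, x) \in words s n by apply: IHx; lia.
have hy' : (q, y) \in words s n by apply: IHy; lia.
exact: (allpairs_f (fun u v : nat * A => ((u.1 + v.1)%N, u.2 ** v.2)) hx' hy').
Qed.

Lemma words_sound s n p : p \in words s n -> nprod [set` s] p.1 p.2.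
Proof.
elim: n p => //= n IH p; rewrite mem_cat => /orP[/mapP[x hx ->]|].
  exact: NProd1.
by move=> /allpairsP[[u v] [/IH hu /IH hv ->]]; apply: NProdM.
Qed.

Definition short_span s (T : nat) : set A :=
  lspan [set x | exists2 t, (t < T)%N & nprod [set` s] t x].

Lemma short_span_le s T T' : (T <= T')%N -> short_span s T `<=` short_span s T'.
Proof.
move=> hT; apply: lspan_min; first exact: lspan_submod.
by move=> x [t ht hx]; apply: lspan_in; exists t => //; apply: leq_trans hT.
Qed.

Lemma nprod_subalg_gen s t x : nprod [set` s] t x -> subalg_gen [set` s] x.
Proof.
move=> hx; apply: (nprod_subalg (subalg_genP s)).
by apply: nprod_sub hx => y; apply: subalg_gen_in.
Qed.

(** Each element of the subalgebra is a combination of products of at least one generator, and the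
    counts add up. *)
Lemma nprod_generators s m : nprod (subalg_gen [set` s]) m `<=`
  lspan [set x | exists2 t, (m <= t)%N & nprod [set` s] t x].
Proof.
pose N m : set A := lspan [set x | exists2 t, (m <= t)%N & nprod [set` s] t x].
have hN m' : is_submod (N m') by exact: lspan_submod.
have NM p q x y : N p x -> N q y -> N (p + q)%N (x ** y).
  move=> hx; move: y; apply: (lspan_min (N := [set y | N (p + q)%N (x ** y)])).
    by apply: submod_preim => // [u v|a u]; [exact: nmulDr|exact: nmulZr].
  move=> y [t qt hy]; move: x hx.
  apply: (lspan_min (N := [set x | N (p + q)%N (x ** y)])).
    by apply: submod_preim => // [u v|a u]; [exact: nmulDl|exact: nmulZl].
  move=> x [t' pt hx]; apply: lspan_in; exists (t' + t)%N; first by lia.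
  exact: NProdM.
have N_le p q x : (p <= q)%N -> N q x -> N p x.
  move=> pq; move: x; apply: lspan_min => // x [t qt hx]; apply: lspan_in.
  by exists t => //; apply: leq_trans qt.
have hB : subalg_gen [set` s] `<=` N 1%N.
  apply: subalg_gen_min => [|x hx].
    by split=> // x y hx hy; apply: (N_le _ 2) => //; apply: (NM 1%N 1%N).
  by apply: lspan_in; exists 1%N => //; apply: NProd1.
by move=> x; elim=> {m x} [x /hB//|p q x y _ hx _ hy]; apply: NM.
Qed.

Lemma subalg_gen_short s x : subalg_gen [set` s] x -> exists T, short_span s T x.
Proof.
move: x; apply: subalg_gen_min => [|x hx]; last first.
  by exists 2; apply: lspan_in; exists 1%N => //; apply: NProd1.
split; first split.
- by exists 0%N; apply: submod0 (lspan_submod _).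
- move=> x y [T hx] [T' hy]; exists (maxn T T').
  apply: (submodD (lspan_submod _)).
    by apply: short_span_le hx; apply: leq_maxl.
  by apply: short_span_le hy; apply: leq_maxr.
- by move=> a x [T hx]; exists T; apply: (submodZ _ (lspan_submod _)).
move=> x y [T hx] [T' hy]; exists (T + T')%N.
move: x hx; apply: (lspan_min (N := [set x | short_span s (T + T') (x ** y)])).
  apply: submod_preim => [u v|a u|]; [exact: nmulDl|exact: nmulZl|].
  exact: lspan_submod.
move=> x [t ht hx]; move: y hy.
apply: (lspan_min (N := [set y | short_span s (T + T') (x ** y)])).
  apply: submod_preim => [u v|a u|]; [exact: nmulDr|exact: nmulZr|].
  exact: lspan_submod.
move=> y [t' ht' hy]; apply: lspan_in; exists (t + t')%N; first by lia.
exact: NProdM.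
Qed.

Lemma short_span_bound s n (a : 'I_n -> A) :
  (forall i, subalg_gen [set` s] (a i)) ->
  exists T, forall i, short_span s T (a i).
Proof.
move=> ha; have [T hT] := choice (fun i => subalg_gen_short (ha i)).
exists (\max_i T i) => i; apply: short_span_le (hT i).
exact: leq_bigmax.
Qed.

End Words.

(** * Closure under extensions *)

Section Extension.
Variables (Phi : comPzRingType) (A : nalgType Phi).
Hypothesis half_in_Phi : exists h : Phi, h *+ 2 = 1.
Hypothesis A_jordan : noncommutative_jordan A.
Variable Z : set Phi.
Hypothesis Z_ideal : is_submod (Z : set Phi^o).
Variables (I : ideal A) (s : seq A) (M : nat).
Hypothesis I_finite : locally_finite_over Z I.
Hypothesis long_jdec : forall t x, (M <= t)%N -> nprod [set` s] t x -> jdec s t x.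

Let B := subalg_gen [set` s].
Let short := [set x | exists2 t, (t < M)%N & nprod [set` s] t x].

Hypothesis long_mod : forall t x, (M <= t)%N -> nprod [set` s] t x ->
  exists u, [/\ ideal_set I u, B u & scalar_span Z short (x - u)].

Let short_words := [seq p <- words s M | (p.1 < M)%N].
Let n := size short_words.
Let wt (i : 'I_n) : nat := (nth (0%N, 0) short_words i).1.
Let elt (i : 'I_n) : A := (nth (0%N, 0) short_words i).2.

Let short_elt t x : nprod [set` s] t x -> (t < M)%N ->
  exists i, wt i = t /\ elt i = x.
Proof.
move=> hx ht; have hin : (t, x) \in short_words.
  by rewrite mem_filter ht; apply: words_complete hx (ltnW ht).
have hi : (index (t, x) short_words < n)%N by rewrite index_mem.
by exists (Ordinal hi); rewrite /wt /elt /= nth_index.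
Qed.

Let elt_short i : (wt i < M)%N /\ nprod [set` s] (wt i) (elt i).
Proof.
have : nth (0%N, 0) short_words i \in short_words by apply: mem_nth.
by rewrite mem_filter => /andP[h1 /words_sound h2].
Qed.

Let letter w (i : 'I_n) (l : A) := exists c : Phi,
  l = c *: elt i /\ (wt i = w \/ (wt i < w)%N /\ Z c).

Let generator v (y : A) := exists i, wt i = v /\ y = elt i.

Let letter_colour w i l : letter w i l -> exists c, l = c *: elt i.
Proof. by case=> c [-> _]; exists c. Qed.

Let penalized_letters w : penalized Z generator w `<=` letters letter w.
Proof.
apply: penalized_min => [|x [i [hi ->]]|v y c [i [<- ->]] hv hc].
- exact: lspan_submod.
- by apply: lspan_in; exists i, 1; rewrite scale1r; split=> //; left.
- by apply: lspan_in; exists i, c; split=> //; right.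
Qed.

(** A short word has weight below [M], so from weight [M] on its coefficient must come from [Z]. *)
Let letters_short w : (M <= w)%N -> letters letter w `<=` scalar_span Z short.
Proof.
move=> hw; apply: lspan_min; first exact: lspan_submod.
move=> _ [i [c [-> hc]]]; have [lt_wt hi] := elt_short i.
apply: scalar_span_scale; first by case: hc => [|[]//]; lia.
by apply: lspan_in; exists (wt i).
Qed.

Let short_generator w : (M <= w)%N -> scalar_span Z short `<=` penalized Z generator w.
Proof.
move=> hw; apply: lspan_min; first exact: lspan_submod.
move=> _ [c [y [hc [t ht hy] ->]]].
have [i [_ <-]] := short_elt hy ht; have [lt_wt _] := elt_short i.
apply: (penalized_raise Z_ideal _ _ hc (v := wt i)); last by lia.
by apply: penalized_in; exists i.
Qed.

(** Below weight [M] the Jordan product is a sum of two short words and [u] is 0; from there on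
    [long_mod] provides [u]. *)
Let product_split (ij : 'I_n * 'I_n) : exists u, [/\ ideal_set I u, B u &
  penalized Z generator (wt ij.1 + wt ij.2) (elt ij.1 ∘ elt ij.2 - u)].
Proof.
case: ij => i j /=.
have [_ hi] := elt_short i; have [_ hj] := elt_short j.
have hij := NProdM hi hj; have hji := NProdM hj hi; rewrite addnC in hji.
have [I_submod _] := idealP I; have [B_submod _] := subalg_genP s.
case: (ltnP (wt i + wt j) M) => hM.
  exists 0; split; [exact: (submod0 I_submod)|exact: (submod0 B_submod)|].
  rewrite subr0 jmulE; apply: (submodD (penalized_submod _ _ _)).
    by apply: penalized_in; have [k [? ?]] := short_elt hij hM; exists k.
  by apply: penalized_in; have [k [? ?]] := short_elt hji hM; exists k.
have [u [Iu Bu hu]] := long_mod hM hij; have [v [Iv Bv hv]] := long_mod hM hji.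
exists (u + v); split; [exact: (submodD I_submod)|exact: (submodD B_submod)|].
apply: (short_generator hM).
have -> : elt i ∘ elt j - (u + v) = (elt i ** elt j - u) + (elt j ** elt i - v).
  by rewrite jmulE; zmod.
exact: (submodD (scalar_span_submod _ _)).
Qed.

(** The finitely many elements [u_ij], chosen once for all. *)
Let rest : {rest : 'I_n * 'I_n -> A | forall ij, [/\ ideal_set I (rest ij), B (rest ij) &
  penalized Z generator (wt ij.1 + wt ij.2) (elt ij.1 ∘ elt ij.2 - rest ij)]}.
Proof.
apply: cid; have [f hf] := choice product_split; by exists f.
Qed.

Let rest_list := [seq (wt i + wt j, sval rest (i, j))%N | i <- enum 'I_n, j <- enum 'I_n].

Let base w : set A := penalized Z (fun v y => (v, y) \in rest_list) w.

(** If either letter has a raised weight, its coefficient is in the ideal [Z], so [c * d] pays for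
    raising the product. *)
Let letter_mul w i l w' i' l' : letter w i l -> letter w' i' l' ->
  exists a u, [/\ l ∘ l' = a + u, letters letter (w + w') a & base (w + w') u].
Proof.
case=> c [-> hc] [d [-> hd]].
have [_ _ hr] := svalP rest (i, i'); set r := sval rest _ in hr.
have hbase : base (wt i + wt i') r.
  apply: penalized_in.
  apply: (allpairs_f (fun i j => (wt i + wt j, sval rest (i, j))%N)); exact: mem_enum.
have weight : (wt i + wt i' = w + w')%N \/ (wt i + wt i' < w + w')%N /\ Z (c * d).
  case: hc hd => [ec|[lc Zc]] [ed|[ld Zd]]; first by left; rewrite ec ed.
  - by right; split; [lia|apply: (scalar_mul Z_ideal)].
  - by right; split; [lia|rewrite mulrC; apply: (scalar_mul Z_ideal)].
  - by right; split; [lia|apply: (scalar_mul Z_ideal)].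
exists ((c * d) *: (elt i ∘ elt i' - r)), ((c * d) *: r); split.
- by rewrite jmulZl jmulZr scalerA -scalerDr subrK.
- apply: penalized_letters.
  have [e|[lt_w Zcd]] := weight.
    by rewrite -e; apply: (submodZ _ (penalized_submod _ _ _)).
  by apply: (penalized_raise Z_ideal) lt_w Zcd.
have [e|[lt_w Zcd]] := weight.
  by rewrite -e; apply: (submodZ _ (penalized_submod _ _ _)).
by apply: (penalized_raise Z_ideal) lt_w Zcd.
Qed.

Let filt := fil letter base.

(** By [long_jdec], a long word is a combination of Jordan products of shorter words, to which
    induction applies. The number [k] of factors is not controlled here. *)
Let split_word t x : nprod [set` s] t x ->
  exists a u k, [/\ x = a + u, letters letter t a & filt k t u].
Proof.
pose N t : set A := fun x =>
  exists a u k, [/\ x = a + u, letters letter t a & filt k t u].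
have hN t' : is_submod (N t').
  split=> [|_ _ [a [u [k [-> ha hu]]]] [b [v [m [-> hb hv]]]]|c _ [a [u [k [-> ha hu]]]]].
  - exists 0, 0, 1; split; [by rewrite addr0|exact: submod0 (lspan_submod _)|].
    exact: fil_zero.
  - exists (a + b), (u + v), (maxn k m); split; first by zmod.
      exact: (submodD (lspan_submod _)).
    by apply: fil_add; [apply: fil_le hu _|apply: fil_le hv _]; lia.
  exists (c *: a), (c *: u), k; split; first by rewrite scalerDr.
    exact: (submodZ _ (lspan_submod _)).
  exact: fil_scale.
have fil_N k t' u : filt k t' u -> N t' u.
  move=> hu; exists 0, u, k; split=> //; first by rewrite add0r.
  exact: submod0 (lspan_submod _).
elim/ltn_ind: t x => t IH x hx; case: (ltnP t M) => ht.
  have [i [ei ex]] := short_elt hx ht.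
  exists x, 0, 1; split; [by rewrite addr0| |exact: fil_zero].
  apply: lspan_in; exists i, 1; rewrite scale1r ex; split=> //; by left.
move: x {hx} (long_jdec ht hx); apply: lspan_min; first exact: hN.
move=> _ [p [q [x [y [et hx hy ->]]]]].
have p_gt0 := nprod_gt0 hx; have q_gt0 := nprod_gt0 hy.
have lp : (p < t)%N by lia.
have lq : (q < t)%N by lia.
have [a [u [k [-> ha hu]]]] := IH p lp x hx.
have [b [v [m [-> hb hv]]]] := IH q lq y hy.
rewrite -et jmulDl !jmulDr; apply: (submodD (hN _)).
  apply: (submodD (hN _)).
    apply: (jmul_span (hN _) _ ha hb) => l l' [i hl] [j hl'].
    have [a' [u' [-> ha' hu']]] := letter_mul hl hl'.
    by exists a', u', 1; split=> //; apply: fil_base.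
  by rewrite jmulC addnC; apply: (fil_N m.+1); apply: fil_letters.
apply: (submodD (hN _)); first by apply: (fil_N k.+1); apply: fil_letters.
by apply: (fil_N (k + m)%N); apply: fil_mul.
Qed.

(** Finitely many weighted elements that span, with penalties, all of [filt t]. *)
Fixpoint fil_list (t : nat) : seq (nat * A) :=
  if t is t'.+1 then
    let L := fil_list t' in
    L ++ rest_list ++
    [seq ((p.1 + wt i)%N, p.2 ∘ elt i) | p <- L, i <- enum 'I_n] ++
    [seq ((p.1 + q.1)%N, p.2 ∘ q.2) | p <- L, q <- L]
  else [::].

Let fil_list_le t t' : (t <= t')%N -> {subset fil_list t <= fil_list t'}.
Proof.
elim: t' => [|t' IH]; first by rewrite leqn0 => /eqP->.
rewrite leq_eqVlt => /orP[/eqP->//|/IH h p /h hp].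
by rewrite /= mem_cat hp.
Qed.

Let fil_penalized t w x :
  filt t w x -> penalized Z (fun v y => (v, y) \in fil_list t) w x.
Proof.
rewrite /filt; elim=> {t w x} [w x|t w _|t w x y _ hx _ hy|t w a x _ hx|t w x _|
    t w x w' i l _ hx [c [-> hc]]|t w x t' w' y fx hx fy hy].
- apply: (penalized_sub Z_ideal) => v y hy.
  by rewrite /= mem_cat hy.
- exact: submod0 (penalized_submod _ _ _).
- exact: (submodD (penalized_submod _ _ _)).
- exact: (submodZ _ (penalized_submod _ _ _)).
- by apply: (penalized_sub Z_ideal) => v y; apply: fil_list_le.
- have helt : penalized Z generator w' (c *: elt i).
    case: hc => [<-|[lt_w Zc]].
      apply: (submodZ _ (penalized_submod _ _ _)).
      by apply: penalized_in; exists i.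
    apply: (penalized_raise Z_ideal) lt_w Zc.
    by apply: penalized_in; exists i.
  apply: (penalized_mul Z_ideal _ hx helt) => v y v' _ hy [j [<- ->]].
  apply: penalized_in; rewrite /= !mem_cat; apply/or4P; apply: Or43.
  exact: (allpairs_f (fun (p : nat * A) i => ((p.1 + wt i)%N, p.2 ∘ elt i))
    hy (mem_enum _ j)).
have t_gt0 := fil_gt0 fx; have t'_gt0 := fil_gt0 fy.
apply: (penalized_mul Z_ideal _ hx hy) => v u v' u' hu hu'.
apply: penalized_in.
have [m em] : exists m, (t + t')%N = m.+1 by exists (t + t').-1; lia.
have ltm : (t <= m)%N by lia.
have lt'm : (t' <= m)%N by lia.
rewrite em /= !mem_cat; apply/or4P; apply: Or44.
exact: (allpairs_f (fun p q : nat * A => ((p.1 + q.1)%N, p.2 ∘ q.2))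
  (fil_list_le ltm hu) (fil_list_le lt'm hu')).
Qed.

Let fil_list_ideal t p : p \in fil_list t -> ideal_set I p.2 /\ B p.2.
Proof.
have [I_submod I_mul] := idealP I; have [B_submod B_mul] := subalg_genP s.
have mul x y : ideal_set I x /\ B x -> B y -> ideal_set I (x ∘ y) /\ B (x ∘ y).
  move=> [Ix Bx] By; rewrite jmulE; have [Ixy Iyx] := I_mul x y Ix.
  by split; [apply: (submodD I_submod)|apply: (submodD B_submod); apply: B_mul].
elim: t p => //= t IH p; rewrite !mem_cat => /or4P[/IH//| | |].
- by case/allpairsP=> -[i j] /= [_ _ ->]; have [] := svalP rest (i, j).
- case/allpairsP=> -[q i] /= [/IH hq _ ->]; apply: mul => //.
  exact: nprod_subalg_gen (elt_short i).2.
by case/allpairsP=> -[q q'] /= [/IH hq /IH[_ hq'] ->]; apply: mul.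
Qed.

(** Local finiteness of [I] is applied to the subalgebra [C] generated by elements with boundedly
    many factors. Large weight then forces a coefficient from [Z] or many factors from [C]. *)
Lemma extension_finite_over : finite_over Z B.
Proof.
(* The bound is that of [fil_ind_bounded]. *)
pose L := fil_list (n.+2 * n.+1).
pose s' := [seq p.2 | p <- L].
pose C := subalg_gen [set` s'].
have C_subalg : is_subalg C by exact: subalg_genP.
have s'I : [set` s'] `<=` I.
  by move=> _ /mapP[p /fil_list_ideal[hp _] ->].
have CB : C `<=` B.
  apply: subalg_gen_min; first exact: subalg_genP.
  by move=> _ /mapP[p /fil_list_ideal[_ hp] ->].
have [r [k [c [r_gt0 Cc hr]]]] := I_finite s'I.
(* Weights in [L] are below [W]; the successor keeps [W] positive, so that it can be cancelled
   later. *)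
pose W := (\max_(p <- L) p.1).+1.
pose Y w : set A := lspan [set x | scalar_span Z C x \/
  exists2 q, (w <= q * W)%N & nprod C q x].
have Y_submod w : is_submod (Y w) by exact: lspan_submod.
have YS w x : scalar_span Z C x -> Y w x by move=> hx; apply: lspan_in; left.
have SC_mul x y : scalar_span Z C x -> C y -> scalar_span Z C (x ∘ y).
  move=> hx hy; move: x hx.
  apply: lspan_min; first by apply: submod_jmull; apply: scalar_span_submod.
  move=> _ [a [x [ha hx ->]]] /=; rewrite jmulZl.
  apply: (scalar_span_scale ha); apply: lspan_in; rewrite jmulE.
  by apply: (submodD C_subalg.1); apply: C_subalg.2.
have fil_Y t w x : filt t w x -> Y w x.
  apply: (fil_ind_bounded A_jordan half_in_Phi letter_colour letter_mul Y_submod).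
    move=> {}t {}w {}x ht /fil_penalized.
    have LC v y : (v, y) \in fil_list t -> C y /\ (v <= W)%N.
      move=> /(fil_list_le (ltnW ht)) hy; split.
        by apply: subalg_gen_in; apply/mapP; exists (v, y).
      by apply: leqW; apply: (leq_bigmax_seq (F := fun p : nat * A => p.1) _ hy).
    apply: penalized_min => // [y /LC[hy hw]|v y a /LC[hy _] _ ha].
      apply: lspan_in; right; exists 1; first by rewrite mul1n.
      exact: NProd1.
    by apply: YS; apply: (scalar_span_scale ha); apply: lspan_in.
  move=> {}w {}x w' y hx hy.
  apply: (jmul_span (Y_submod _) _ hx hy) => {hx hy}{}x {}y.
  case=> [hx|[q hq hx]]; case=> [hy|[q' hq' hy]].
  - apply: YS; apply: SC_mul hx _; move: y hy.
    apply: lspan_min; first exact: C_subalg.1.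
    by move=> _ [a [y [_ hy ->]]]; apply: (submodZ _ C_subalg.1).
  - by apply: YS; apply: SC_mul hx _; apply: nprod_subalg hy.
  - by apply: YS; rewrite jmulC; apply: SC_mul hy _; apply: nprod_subalg hx.
  have hqq : (w + w' <= (q + q') * W)%N by lia.
  rewrite jmulE; apply: (submodD (Y_submod _)); apply: lspan_in; right.
    by exists (q + q')%N => //; apply: NProdM.
  by exists (q + q')%N => //; rewrite addnC; apply: NProdM.
(* Short words span the letters; short products of generators of [C] and the elements [c i] span
   [C]. *)
pose F := [seq p.2 | p <- short_words] ++ [seq p.2 | p <- words s' r] ++ codom c.
have F_in x : x \in F -> B x.
  rewrite !mem_cat => /or3P[/mapP[p hp ->]|/mapP[p hp ->]|/codomP[i ->]].
  - move: hp; rewrite mem_filter => /andP[_ /words_sound]; exact: nprod_subalg_gen.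
  - exact: CB (nprod_subalg_gen (words_sound hp)).
  - exact: CB (Cc i).
have short_F : short `<=` lspan [set` F].
  move=> x [t ht hx]; have [i [_ <-]] := short_elt hx ht.
  apply: lspan_in => /=; rewrite mem_cat; apply/orP; left; apply/map_f/mem_nth.
  exact: ltn_ord.
have c_F i : lspan [set` F] (c i).
  by apply: lspan_in; rewrite /= !mem_cat codom_f !orbT.
have C_F : C `<=` lspan [set` F].
  have hN := lspan_submod [set` F].
  move=> x /subalg_gen_short[T]; move: x; apply: lspan_min => // x [t _ hx].
  case: (leqP t r) => tr.
    apply: lspan_in => /=; rewrite !mem_cat; apply/orP; right; apply/orP; left.
    by apply/mapP; exists (t, x) => //; apply: words_complete.
  have : Zspan Z c x.
    apply: hr; apply: lspan_in; apply: (nprod_le (t := t)) => //.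
      by apply: nprod_sub hx => y; apply: subalg_gen_in.
    by rewrite r_gt0 ltnW.
  by case=> z _ ->; apply: submod_sum => // i _; apply: (submodZ _ hN).
have long_F t x : (M <= t)%N -> (r * W <= t)%N -> nprod [set` s] t x ->
    scalar_span Z [set` F] x.
  move=> Mt rt /split_word[a [u [j [-> ha hu]]]].
  apply: (submodD (scalar_span_submod _ _)).
    exact: (scalar_span_sub short_F) (letters_short Mt ha).
  have {hu} := fil_Y _ _ _ hu; move: u.
  apply: lspan_min; first exact: scalar_span_submod.
  move=> u [hu|[q hq hu]]; first exact: (scalar_span_sub C_F) hu.
  apply: (Zspan_scalar_span c_F); apply: hr; apply: lspan_in.
  (* Cancelling [W] in [r * W <= t <= q * W] gives [r <= q]. *)
  apply: (nprod_le C_subalg hu); rewrite r_gt0 -(leq_pmul2r (m := W)) //.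
  exact: leq_trans hq.
exists (maxn (r * W) M), (size F), (fun i => F`_i); split.
- by rewrite leq_max muln_gt0 r_gt0.
- by move=> i; apply: F_in; apply: mem_nth.
move=> x hx; apply: (scalar_span_Zspan Z_ideal).
move: x hx; apply: lspan_min; first exact: scalar_span_submod.
move=> x /nprod_generators; move: x; apply: lspan_min; first exact: scalar_span_submod.
by move=> x [t]; rewrite geq_max => /andP[rt Mt]; apply: long_F.
Qed.

End Extension.

(** * The radical *)

Section HomomorphicImage.
Variables (Phi : comPzRingType) (A B : nalgType Phi) (f : A -> B).
Hypotheses (fD : {morph f : x y / x + y}) (fZ : forall a x, f (a *: x) = a *: f x).
Hypothesis fM : {morph f : x y / x ** y}.
Variable Z : set Phi.
Hypothesis Z_ideal : is_submod (Z : set Phi^o).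

Lemma subalg_gen_image (s : seq A) y : subalg_gen [set` map f s] y ->
  exists2 x, subalg_gen [set` s] x & f x = y.
Proof.
have [[S0 SD SZ] SM] := subalg_genP s.
move: y; apply: subalg_gen_min => [|_ /mapP[x hx ->]]; last first.
  by exists x => //; apply: subalg_gen_in.
split; first split.
- by exists 0 => //; rewrite (hom0 fZ).
- by move=> _ _ [x hx <-] [y hy <-]; exists (x + y); [exact: SD|rewrite fD].
- by move=> a _ [x hx <-]; exists (a *: x); [exact: SZ|rewrite fZ].
by move=> _ _ [x hx <-] [y hy <-]; exists (x ** y); [exact: SM|rewrite fM].
Qed.

Lemma nprod_image (C : set A) (D : set B) m y :
  (forall y, D y -> exists2 x, C x & f x = y) ->
  nprod D m y -> exists2 x, nprod C m x & f x = y.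
Proof.
move=> hD; elim=> {m y} [y /hD[x hx <-]|p q _ _ _ [x hx <-] _ [y hy <-]].
  by exists x => //; apply: NProd1.
by exists (x ** y) => //; apply: NProdM.
Qed.

Lemma nprod_morph (C : set A) (D : set B) m x :
  (forall x, C x -> D (f x)) -> nprod C m x -> nprod D m (f x).
Proof.
move=> hC; elim=> {m x} [x /hC|p q x y _ hx _ hy]; first exact: NProd1.
by rewrite fM; apply: NProdM.
Qed.

Lemma subalg_gen_morph (s : seq A) x :
  subalg_gen [set` s] x -> subalg_gen [set` map f s] (f x).
Proof.
have [[S0 SD SZ] SM] := subalg_genP (map f s).
move: x; apply: subalg_gen_min => [|x hx]; last first.
  by apply: subalg_gen_in; apply: map_f.
split; first split.
- by rewrite (hom0 fZ).
- by move=> x y hx hy; rewrite fD; apply: SD.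
- by move=> a x hx; rewrite fZ; apply: SZ.
by move=> x y hx hy; rewrite fM; apply: SM.
Qed.

Lemma finite_over_image (s : seq A) : finite_over Z (subalg_gen [set` s]) ->
  finite_over Z (subalg_gen [set` map f s]).
Proof.
move=> [m [n [a [m_gt0 ha hm]]]]; exists m, n, (f \o a); split=> // [i|].
  exact: subalg_gen_morph.
apply: lspan_min; first exact: Zspan_submod.
move=> y /(nprod_image (@subalg_gen_image s))[x hx <-].
have [z hz ->] := hm x (lspan_in hx); exists z => //.
by rewrite (big_morph f fD (hom0 fZ)); apply: eq_bigr => i _; rewrite fZ.
Qed.

Lemma locally_finite_over_image : (forall y, exists x, f x = y) ->
  locally_finite_over Z (@setT A) -> locally_finite_over Z (@setT B).
Proof.
move=> /choice[g hg] hA s _.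
have -> : s = map f (map g s).
  by rewrite -map_comp -[LHS]map_id; apply: eq_map => y /=; rewrite hg.
exact/finite_over_image/hA.
Qed.

End HomomorphicImage.

(** * Sums of locally finite ideals and the radical *)

Section Radical.
Variables (Phi : comPzRingType) (V : variety Phi).
Hypothesis half_in_Phi : exists h : Phi, h *+ 2 = 1.
Hypothesis V_homogeneous : homogeneous_variety V.
Hypothesis V_jordan : noncommutative_jordan_variety V.
Hypothesis V_admissible : locally_admissible V.
Variable Z : set Phi.
Hypothesis Z_ideal : is_submod (Z : set Phi^o).
Variable A : nalgType Phi.
Hypothesis A_in : in_variety V A.
Implicit Types I J : ideal A.

Lemma finite_over_extension I (s : seq A) : locally_finite_over Z I ->
  finite_over Z (subalg_gen [set` map (proj I) s]) ->
  finite_over Z (subalg_gen [set` s]).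
Proof.
move=> I_finite [m [n [a [m_gt0 ha hm]]]].
have [N _ hN] := long_product_jdec half_in_Phi V_homogeneous V_jordan
  V_admissible (size s).
have image := @subalg_gen_image _ _ _ _ (@projD _ _ I) (@projZ _ _ I) (@projM _ _ I) s.
have /choice[b hb] : forall i, exists x, subalg_gen [set` s] x /\ proj I x = a i.
  by move=> i; have [x hx <-] := image _ (ha i); exists x.
have [T hT] := short_span_bound (fun i => (hb i).1).
(* [T] bounds the length of the lifts [b i], [m] brings long products into the span of the [a i]
   modulo [I], and [N] makes them Jordan decomposable. *)
pose M := maxn T (maxn m N).
apply: (extension_finite_over (M := M) half_in_Phi (V_jordan A_in) Z_ideal I_finite).
  move=> t x Mt; apply: hN => //; apply: leq_trans Mt.
  by rewrite /M !leq_max leqnn !orbT.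
move=> t x Mt hx.
have mt : (m <= t)%N by apply: leq_trans Mt; rewrite /M !leq_max leqnn !orbT.
have : Zspan Z a (proj I x).
  apply: hm; apply: lspan_in.
  have hpx := nprod_morph (@projM _ _ I) (@subalg_gen_morph _ _ _ _ (@projD _ _ I)
    (@projZ _ _ I) (@projM _ _ I) s).
  apply: (nprod_le (t := t)); first exact: subalg_genP.
    by apply: hpx; apply: nprod_sub hx => y; apply: subalg_gen_in.
  by rewrite m_gt0.
case=> z hz ez; have [B_submod _] := subalg_genP s.
exists (x - \sum_i z i *: b i); split.
- apply/proj_eq; rewrite ez (big_morph _ (@projD _ _ I) (hom0 (@projZ _ _ I))).
  by apply: eq_bigr => i _; rewrite projZ (hb i).2.
- apply: (submodB B_submod); first exact: nprod_subalg_gen hx.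
  by apply: (submod_sum _ B_submod) => i _; apply: (submodZ _ B_submod); exact: (hb i).1.
rewrite opprB addrC subrK; apply: submod_sum; first exact: scalar_span_submod.
move=> i _; apply: scalar_span_scale => //.
by apply: short_span_le (hT i); rewrite leq_max leqnn.
Qed.

Lemma ideal_sum_ideal I J :
  is_ideal [set x | exists a b, [/\ ideal_set I a, ideal_set J b & x = a + b]].
Proof.
have [IS IM] := idealP I; have [JS JM] := idealP J; split; first split.
- exists 0, 0; split; [exact: submod0 IS|exact: submod0 JS|by rewrite addr0].
- move=> _ _ [a [b [ha hb ->]]] [c [d [hc hd ->]]].
  exists (a + c), (b + d); split; [exact: (submodD IS)|exact: (submodD JS)|zmod].
- move=> k _ [a [b [ha hb ->]]]; exists (k *: a), (k *: b).
  by split; [exact: (submodZ _ IS)|exact: (submodZ _ JS)|rewrite scalerDr].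
move=> _ y [a [b [ha hb ->]]].
split; [exists (a ** y), (b ** y)|exists (y ** a), (y ** b)].
  by split; [exact: (IM _ _ ha).1|exact: (JM _ _ hb).1|rewrite nmulDl].
by split; [exact: (IM _ _ ha).2|exact: (JM _ _ hb).2|rewrite nmulDr].
Qed.

Definition ideal_sum I J := Ideal (ideal_sum_ideal I J).

(** Modulo [J], elements of the sum agree with elements of [I], so the sum is an extension with
    kernel [J]. *)
Lemma ideal_sum_locally_finite I J : locally_finite_over Z I ->
  locally_finite_over Z J -> locally_finite_over Z (ideal_sum I J).
Proof.
move=> hI hJ s hs.
have /choice[g hg] : forall x, exists a,
    ideal_set (ideal_sum I J) x -> ideal_set I a /\ ideal_set J (x - a).
  move=> x; have [[a [b [ha hb ->]]]|hx] := pselect (ideal_set (ideal_sum I J) x).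
    by exists a => _; rewrite addrC addKr.
  by exists 0 => /hx.
apply: (finite_over_extension hJ).
have -> : map (proj J) s = map (proj J) (map g s).
  rewrite -map_comp; apply/eq_in_map => x /hs hx /=.
  by apply/proj_eq; have [] := hg x hx.
apply: (finite_over_image (@projD _ _ J) (@projZ _ _ J) (@projM _ _ J) Z_ideal).
by apply: hI => _ /mapP[x /hs hx ->]; have [] := hg x hx.
Qed.

Lemma zero_ideal : is_ideal [set 0 : A].
Proof.
split; first split=> // [x y -> ->|a x ->]; rewrite ?addr0 ?scaler0 //.
by move=> x y ->; rewrite nmul0l nmul0r.
Qed.

Lemma zero_locally_finite : locally_finite_over Z [set 0 : A].
Proof.
move=> s hs; exists 1%N, 0%N, (fun=> 0); split=> //; first by case.
have h0 : subalg_gen [set` s] `<=` [set 0].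
  apply: subalg_gen_min => //; split=> [|x y -> ->]; last by rewrite nmul0l.
  by have [] := zero_ideal.
apply: lspan_min; first exact: Zspan_submod.
move=> x /(nprod_subalg (subalg_genP s))/h0->.
exact: submod0 (Zspan_submod Z_ideal _).
Qed.

(** A union is enough, since the sum of two locally finite ideals is again one. *)
Definition radical_set : set A :=
  [set x | exists2 I : ideal A, locally_finite_over Z I & ideal_set I x].

Lemma radical_ideal : is_ideal radical_set.
Proof.
split; first split.
- by exists (Ideal zero_ideal) => //; apply: zero_locally_finite.
- move=> x y [I hI Ix] [J hJ Jy].
  by exists (ideal_sum I J); [exact: ideal_sum_locally_finite|exists x, y].
- move=> a x [I hI Ix]; exists I => //.
  by have [IS _] := idealP I; apply: (submodZ _ IS).
move=> x y [I hI Ix]; have [_ /(_ x y Ix)[h1 h2]] := idealP I.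
by split; exists I.
Qed.

Definition radical := Ideal radical_ideal.

(** Finitely many elements of the radical lie in a single locally finite ideal, a finite sum of such
    ideals. *)
Lemma radical_locally_finite : locally_finite_over Z radical.
Proof.
move=> s hs.
suff [I hI sI] : exists2 I : ideal A, locally_finite_over Z I & [set` s] `<=` I.
  exact: hI.
elim: s hs => [|x s IH] hs.
  by exists (Ideal zero_ideal) => //; exact: zero_locally_finite.
have [I hI Ix] : radical_set x by apply: hs; rewrite /= mem_head.
have [J hJ sJ] : exists2 I : ideal A, locally_finite_over Z I & [set` s] `<=` I.
  by apply: IH => y hy; apply: hs; rewrite /= inE hy orbT.
have [IS _] := idealP I; have [JS _] := idealP J.
exists (ideal_sum I J); first exact: ideal_sum_locally_finite.
move=> y; rewrite /= inE => /predU1P[->|/sJ Jy].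
  by exists x, 0; rewrite addr0; split=> //; apply: (submod0 JS).
by exists 0, y; rewrite add0r; split=> //; apply: (submod0 IS).
Qed.

(** The preimage of [J] is an extension of [J] by the radical, hence locally finite and already
    inside the radical. *)
Lemma radical_semisimple (J : ideal (quot_alg radical)) :
  locally_finite_over Z J -> J `<=` [set 0].
Proof.
move=> hJ y; have [x <-] := proj_surj y => Jx.
have [JS JM] := idealP J.
have hK : is_ideal [set x | ideal_set J (proj radical x)].
  split; first by apply: submod_preim => //; [exact: projD|exact: projZ].
  by move=> u v hu /=; rewrite !projM; exact: JM.
apply/proj_eq0; exists (Ideal hK) => // s hs.
apply: (finite_over_extension radical_locally_finite).
by apply: hJ => _ /mapP[u /hs hu ->].
Qed.

End Radical.

Theorem theorem3p2 (Phi : comPzRingType)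
    (half_in_Phi : exists h : Phi, h *+ 2 = 1)
    (V : variety Phi)
    (V_homogeneous : homogeneous_variety V)
    (V_jordan : noncommutative_jordan_variety V)
    (V_admissible : locally_admissible V)
    (Z : set Phi) (Z_ideal : is_submod (Z : set Phi^o)) :
  locally_finite_radical_exists V Z.
Proof.
split=> [A B f _ hA fM fsurj|A hA].
  apply: (locally_finite_over_image _ _ fM Z_ideal fsurj hA) => [x y|a x].
    exact: linearD.
  exact: linearZ.
exists (radical half_in_Phi V_homogeneous V_jordan V_admissible Z_ideal hA); split.
- exact: radical_locally_finite.
- by move=> I hI x Ix; exists I.
- exact: radical_semisimple.
Qed.
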